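(* Let $\mathcal{C}$ be a bicategory and $\mathcal{W}$ a family of arrows of $\mathcal{C}$ containing the identities. Assume that $\mathcal{W}$ satisfies the 3 for 2 property, and that any arrow of $\mathcal{W}$ can be written, up to an invertible 2-cell, as a composition of split arrows belonging to $\mathcal{W}$. Then the 2-functor $i:\mathcal{C}\to \mathcal{H}o(\mathcal{C},\mathcal{W})$ is the strict localization of $\mathcal{C}$ with respect to $\mathcal{W}$; that is, $i$ maps the arrows of $\mathcal{W}$ to equivalences and, for every bicategory $\mathcal{D}$, precomposition with $i$ is an isomorphism of bicategories $$i^*:\mathrm{Hom}(\mathcal{H}o(\mathcal{C},\mathcal{W}),\mathcal{D})\longrightarrow \mathrm{Hom}_{(\mathcal{W},\Theta)}(\mathcal{C},\mathcal{D}).$$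
   Context: **Conventions.** In a bicategory, $\circ$ is vertical composition of 2-cells and $*$ is horizontal composition ($g*f$ means first $f$, then $g$); an arrow also denotes its identity 2-cell, so $r*\alpha$ and $\alpha*\ell$ are whiskerings. By coherence, parentheses and identity arrows in horizontal composites of arrows are omitted, and associators and unitors are inserted tacitly. A pseudofunctor $F$ has invertible structural 2-cells $\phi:Fg*Ff\Rightarrow F(g*f)$ and $\xi:id_{FX}\Rightarrow F(id_X)$ satisfying the usual axioms (their inverses are denoted by the same letters). A 2-functor is a pseudofunctor between bicategories all of whose structural 2-cells $\phi,\xi$ are identities. An arrow $f:X\to Y$ is an equivalence if there are $g:Y\to X$ and invertible 2-cells $g*f\cong id_X$, $f*g\cong id_Y$; it is a quasiequivalence if for every object $Z$ the functors $f_*:\mathcal{C}(Z,X)\to\mathcal{C}(Z,Y)$ and $f^*:\mathcal{C}(Y,Z)\to\mathcal{C}(X,Z)$ are full and faithful. $\Theta$ and $\Theta_q$ denote the families of equivalences and of quasiequivalences of a bicategory. Writing $F:(\mathcal{C},\mathcal{W})\to(\mathcal{D},\Gamma)$ means that $F$ maps the arrows of $\mathcal{W}$ into $\Gamma$. **Cylinders and homotopies.** A cylinder for $X\in\mathcal{C}$ (with respect to $\mathcal{W}$) is $C=(W,Z,d_0,d_1,x,s,\alpha_0,\alpha_1)$ with $d_0,d_1:X\to W$, $x:X\to Z$, $s:W\to Z$ an arrow in $\mathcal{W}$, and invertible 2-cells $\alpha_0:s*d_0\Rightarrow x$, $\alpha_1:s*d_1\Rightarrow x$; put $\alpha=\alpha_1^{-1}\circ\alpha_0:s*d_0\Rightarrow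 s*d_1$. For $f,g:X\to Y$, a homotopy $H$ from $f$ to $g$ is $H=(C,h,\eta,\varepsilon)$ with $C$ a cylinder for $X$, $h:W\to Y$ an arrow, and 2-cells $\eta:f\Rightarrow h*d_0$, $\varepsilon:h*d_1\Rightarrow g$ (not necessarily invertible). For $r:Y\to Y'$, $r*H$ is the homotopy from $r*f$ to $r*g$ with the same cylinder, arrow $r*h$ and 2-cells $r*\eta$, $r*\varepsilon$. For $\ell:X'\to X$, $H*\ell$ is the homotopy from $f*\ell$ to $g*\ell$ with cylinder $(W,Z,d_0*\ell,d_1*\ell,x*\ell,s,\alpha_0*\ell,\alpha_1*\ell)$, arrow $h$ and 2-cells $\eta*\ell$, $\varepsilon*\ell$. **The 2-cells $\widehat{FH}$.** For a 2-functor $F:(\mathcal{C},\mathcal{W})\to(\mathcal{D},\Theta_q)$, let $\widehat{FC}:Fd_0\Rightarrow Fd_1$ be the unique (invertible) 2-cell with $Fs*\widehat{FC}=F\alpha$, and let $\widehat{FH}=F\varepsilon\circ(Fh*\widehat{FC})\circ F\eta:Ff\Rightarrow Fg$. For a 2-cell $\mu:f\Rightarrow g$ of $\mathcal{C}$, $I^\mu$ denotes any homotopy from $f$ to $g$ with $\widehat{FI^\mu}=F\mu$ for every such 2-functor $F$; for instance one may take the homotopy with cylinder $(X,X,id_X,id_X,id_X,id_X,id,id)$, $h=g$, $\eta=\mu$, $\varepsilon=id_g$ (modulo unitors). **$\mathcal{H}o(\mathcal{C},\mathcal{W})$ and $i$.** The objects, arrows, identity arrows and composition of arrows are those of $\mathcal{C}$.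 A 2-cell $f\Rightarrow g$ is a class $[H^n,\dots,H^1]$ of a finite sequence of composable homotopies ($H^1$ from $f$ to $f_1$, $H^2$ from $f_1$ to $f_2$, ..., $H^n$ from $f_{n-1}$ to $g$), where $[H^n,\dots,H^1]=[K^m,\dots,K^1]$ iff $\widehat{FH^n}\circ\cdots\circ\widehat{FH^1}=\widehat{FK^m}\circ\cdots\circ\widehat{FK^1}$ for every bicategory $\mathcal{D}$ and every 2-functor $F:(\mathcal{C},\mathcal{W})\to(\mathcal{D},\Theta_q)$. Vertical composition is juxtaposition of sequences; the identity 2-cell of $f$ is $[I^{id_f}]$; whiskerings are $r*[H^n,\dots,H^1]=[r*H^n,\dots,r*H^1]$ and $[H^n,\dots,H^1]*\ell=[H^n*\ell,\dots,H^1*\ell]$, and these determine the horizontal composition. The 2-functor $i:\mathcal{C}\to\mathcal{H}o(\mathcal{C},\mathcal{W})$ is the identity on objects and arrows, and $i\mu=[I^\mu]$ on 2-cells; associators and unitors of $\mathcal{H}o(\mathcal{C},\mathcal{W})$ are the images under $i$ of those of $\mathcal{C}$. **Hom bicategories.** $\mathrm{Hom}(\mathcal{C},\mathcal{D})$ is the bicategory of pseudofunctors, pseudonatural transformations and modifications; $\mathrm{Hom}_{(\mathcal{W},\Theta)}(\mathcal{C},\mathcal{D})$ is its full subbicategory on the pseudofunctors mapping the arrows of $\mathcal{W}$ to equivalences. An isomorphism of bicategories is a pseudofunctor having an inverse pseudofunctor (both composites being identities). A pseudofunctor $i:(\mathcal{C},\mathcal{W})\to(\mathcal{E},\Theta)$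 is the localization of $\mathcal{C}$ with respect to $\mathcal{W}$ if for every bicategory $\mathcal{D}$ the pseudofunctor $i^*:\mathrm{Hom}(\mathcal{E},\mathcal{D})\to\mathrm{Hom}_{(\mathcal{W},\Theta)}(\mathcal{C},\mathcal{D})$ is a biequivalence, and a strict localization if each $i^*$ is an isomorphism of bicategories. **3 for 2; split arrows.** $\mathcal{W}$ satisfies 3 for 2 if for every three arrows $f,g,h$ such that there is an invertible 2-cell $g*f\cong h$, whenever two of the three are in $\mathcal{W}$ so is the third. If $s:X\to Y$, $r:Y\to X$ and there is an invertible 2-cell $r*s\cong id_X$, then $s$ is called a section and $r$ a retraction. An arrow is split if it is a section or a retraction. *)

(* Defs.v *)
From Corelib Require Import ssreflect ssrfun.
From Stdlib Require Import FunctionalExtensionality PropExtensionality.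
From Stdlib Require Import ProofIrrelevance IndefiniteDescription.

Set Implicit Arguments.
Unset Strict Implicit.
Unset Printing Implicit Defensive.

Declare Scope bicat_scope.
Delimit Scope bicat_scope with bicat.

Reserved Notation "X ⟶ Y" (at level 60, right associativity).
Reserved Notation "f ⇒ g" (at level 70, no associativity).
Reserved Notation "g ⊙ f" (at level 40, left associativity).
Reserved Notation "β ∘ α" (at level 50, left associativity).
Reserved Notation "β ⊛ α" (at level 40, left associativity).

(* [g ⊙ f] is first [f], then [g]; likewise for [β ∘ α].  The primed cells
   [assoc'], [lun'], [run'] are the inverses of the associators and unitors. *)
Record Bicategory := {
  ob :> Type;
  arr : ob -> ob -> Type
    where "X ⟶ Y" := (arr X Y);
  cell : forall X Y, X ⟶ Y -> X ⟶ Y -> Type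
    where "f ⇒ g" := (@cell _ _ f g);
  idA : forall X, X ⟶ X;
  compA : forall X Y Z, Y ⟶ Z -> X ⟶ Y -> X ⟶ Z
    where "g ⊙ f" := (compA g f);
  id2 : forall X Y (f : X ⟶ Y), f ⇒ f;
  vcomp : forall X Y (f g h : X ⟶ Y), g ⇒ h -> f ⇒ g -> f ⇒ h
    where "β ∘ α" := (vcomp β α);
  hcomp : forall X Y Z (g g' : Y ⟶ Z) (f f' : X ⟶ Y),
    g ⇒ g' -> f ⇒ f' -> g ⊙ f ⇒ g' ⊙ f'
    where "β ⊛ α" := (hcomp β α);
  assoc : forall X Y Z T (h : Z ⟶ T) (g : Y ⟶ Z) (f : X ⟶ Y),
    (h ⊙ g) ⊙ f ⇒ h ⊙ (g ⊙ f);
  assoc' : forall X Y Z T (h : Z ⟶ T) (g : Y ⟶ Z) (f : X ⟶ Y),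
    h ⊙ (g ⊙ f) ⇒ (h ⊙ g) ⊙ f;
  lun : forall X Y (f : X ⟶ Y), idA Y ⊙ f ⇒ f;
  lun' : forall X Y (f : X ⟶ Y), f ⇒ idA Y ⊙ f;
  run : forall X Y (f : X ⟶ Y), f ⊙ idA X ⇒ f;
  run' : forall X Y (f : X ⟶ Y), f ⇒ f ⊙ idA X;
  vassoc : forall X Y (f g h k : X ⟶ Y) (c : h ⇒ k) (b : g ⇒ h) (a : f ⇒ g),
    (c ∘ b) ∘ a = c ∘ (b ∘ a);
  vidl : forall X Y (f g : X ⟶ Y) (a : f ⇒ g), id2 g ∘ a = a;
  vidr : forall X Y (f g : X ⟶ Y) (a : f ⇒ g), a ∘ id2 f = a;
  hcomp_id : forall X Y Z (g : Y ⟶ Z) (f : X ⟶ Y),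
    id2 g ⊛ id2 f = id2 (g ⊙ f);
  interchange : forall X Y Z (g g' g'' : Y ⟶ Z) (f f' f'' : X ⟶ Y)
      (b' : g' ⇒ g'') (b : g ⇒ g') (a' : f' ⇒ f'') (a : f ⇒ f'),
    (b' ∘ b) ⊛ (a' ∘ a) = (b' ⊛ a') ∘ (b ⊛ a);
  assoc_nat : forall X Y Z T (h h' : Z ⟶ T) (g g' : Y ⟶ Z) (f f' : X ⟶ Y)
      (c : h ⇒ h') (b : g ⇒ g') (a : f ⇒ f'),
    assoc h' g' f' ∘ ((c ⊛ b) ⊛ a) = (c ⊛ (b ⊛ a)) ∘ assoc h g f;
  lun_nat : forall X Y (f f' : X ⟶ Y) (a : f ⇒ f'),
    lun f' ∘ (id2 (idA Y) ⊛ a) = a ∘ lun f;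
  run_nat : forall X Y (f f' : X ⟶ Y) (a : f ⇒ f'),
    run f' ∘ (a ⊛ id2 (idA X)) = a ∘ run f;
  assocK : forall X Y Z T (h : Z ⟶ T) (g : Y ⟶ Z) (f : X ⟶ Y),
    assoc' h g f ∘ assoc h g f = id2 _;
  assoc'K : forall X Y Z T (h : Z ⟶ T) (g : Y ⟶ Z) (f : X ⟶ Y),
    assoc h g f ∘ assoc' h g f = id2 _;
  lunK : forall X Y (f : X ⟶ Y), lun' f ∘ lun f = id2 _;
  lun'K : forall X Y (f : X ⟶ Y), lun f ∘ lun' f = id2 _;
  runK : forall X Y (f : X ⟶ Y), run' f ∘ run f = id2 _;
  run'K : forall X Y (f : X ⟶ Y), run f ∘ run' f = id2 _;
  pentagon : forall X Y Z T U (k : T ⟶ U) (h : Z ⟶ T) (g : Y ⟶ Z) (f : X ⟶ Y),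
    (id2 k ⊛ assoc h g f) ∘ (assoc k (h ⊙ g) f ∘ (assoc k h g ⊛ id2 f))
    = assoc k h (g ⊙ f) ∘ assoc (k ⊙ h) g f;
  triangle : forall X Y Z (g : Y ⟶ Z) (f : X ⟶ Y),
    (id2 g ⊛ lun f) ∘ assoc g (idA Y) f = run g ⊛ id2 f
}.

Arguments arr {_} X Y.
Arguments cell {_ X Y} f g.
Arguments idA {_} X.
Arguments compA {_ X Y Z} g f.
Arguments id2 {_ X Y} f.
Arguments vcomp {_ X Y f g h} β α : rename.
Arguments hcomp {_ X Y Z g g' f f'} β α : rename.
Arguments assoc {_ X Y Z T} h g f.
Arguments assoc' {_ X Y Z T} h g f.
Arguments lun {_ X Y} f.
Arguments lun' {_ X Y} f.
Arguments run {_ X Y} f.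
Arguments run' {_ X Y} f.
Arguments vassoc {_ X Y f g h k c b a}.
Arguments vidl {_ X Y f g a}.
Arguments vidr {_ X Y f g a}.
Arguments hcomp_id {_ X Y Z g f}.
Arguments interchange {_ X Y Z g g' g'' f f' f'' b' b a' a}.
Arguments assoc_nat {_ X Y Z T h h' g g' f f' c b a}.
Arguments lun_nat {_ X Y f f' a}.
Arguments run_nat {_ X Y f f' a}.
Arguments assocK {_ X Y Z T h g f}.
Arguments assoc'K {_ X Y Z T h g f}.
Arguments lunK {_ X Y f}.
Arguments lun'K {_ X Y f}.
Arguments runK {_ X Y f}.
Arguments run'K {_ X Y f}.
Arguments pentagon {_ X Y Z T U k h g f}.
Arguments triangle {_ X Y Z g f}.

Notation "X ⟶ Y" := (arr X Y) : bicat_scope.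
Notation "f ⇒ g" := (cell f g) : bicat_scope.
Notation "g ⊙ f" := (compA g f) : bicat_scope.
Notation "β ∘ α" := (vcomp β α) : bicat_scope.
Notation "β ⊛ α" := (hcomp β α) : bicat_scope.
Notation "r ◁ α" := (hcomp (id2 r) α)
  (at level 40, left associativity) : bicat_scope.
Notation "α ▷ l" := (hcomp α (id2 l))
  (at level 40, left associativity) : bicat_scope.
Open Scope bicat_scope.

Record iso2 (C : Bicategory) (X Y : C) (f g : X ⟶ Y) := {
  fwd :> f ⇒ g;
  bwd : g ⇒ f;
  fwdK : bwd ∘ fwd = id2 f;
  bwdK : fwd ∘ bwd = id2 g
}.
Arguments fwdK {C X Y f g i} : rename.
Arguments bwdK {C X Y f g i} : rename.
Arguments bwd {C X Y f g} i : rename.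

Section Basics.
Variable C : Bicategory.

Lemma post2 (X Y : C) (f g h k : X ⟶ Y) (a : h ⇒ k) (b : g ⇒ h) (c : g ⇒ k) :
  a ∘ b = c -> forall (x : f ⇒ g), a ∘ (b ∘ x) = c ∘ x.
Proof. by move=> <- x; rewrite vassoc. Qed.

Lemma post3 (X Y : C) (f g h k l : X ⟶ Y) (a : k ⇒ l) (b : h ⇒ k) (c : g ⇒ h)
    (d : g ⇒ l) :
  a ∘ (b ∘ c) = d -> forall (x : f ⇒ g), a ∘ (b ∘ (c ∘ x)) = d ∘ x.
Proof. by move=> <- x; rewrite !vassoc. Qed.

Lemma cancel_l (X Y : C) (f g h : X ⟶ Y) (i : g ⇒ h) (j : h ⇒ g) (x y : f ⇒ g) :
  j ∘ i = id2 g -> i ∘ x = i ∘ y -> x = y.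
Proof.
by move=> ji e; rewrite -[x]vidl -[y]vidl -ji !vassoc e.
Qed.

Lemma cancel_r (X Y : C) (f g h : X ⟶ Y) (i : f ⇒ g) (j : g ⇒ f) (x y : g ⇒ h) :
  i ∘ j = id2 g -> x ∘ i = y ∘ i -> x = y.
Proof.
by move=> ji e; rewrite -[x]vidr -[y]vidr -ji -!vassoc e.
Qed.

Lemma lwhisk_comp (X Y Z : C) (r : Y ⟶ Z) (f g h : X ⟶ Y) (b : g ⇒ h) (a : f ⇒ g) :
  r ◁ (b ∘ a) = (r ◁ b) ∘ (r ◁ a).
Proof. by rewrite -interchange vidl. Qed.

Lemma rwhisk_comp (X Y Z : C) (l : X ⟶ Y) (f g h : Y ⟶ Z) (b : g ⇒ h) (a : f ⇒ g) :
  (b ∘ a) ▷ l = (b ▷ l) ∘ (a ▷ l).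
Proof. by rewrite -interchange vidl. Qed.

Lemma exch_rl (X Y Z : C) (g g' : Y ⟶ Z) (f f' : X ⟶ Y) (b : g ⇒ g') (a : f ⇒ f') :
  (b ▷ f') ∘ (g ◁ a) = b ⊛ a.
Proof. by rewrite -interchange vidl vidr. Qed.

Lemma exch_lr (X Y Z : C) (g g' : Y ⟶ Z) (f f' : X ⟶ Y) (b : g ⇒ g') (a : f ⇒ f') :
  (g' ◁ a) ∘ (b ▷ f) = b ⊛ a.
Proof. by rewrite -interchange vidl vidr. Qed.

Lemma exch (X Y Z : C) (g g' : Y ⟶ Z) (f f' : X ⟶ Y) (b : g ⇒ g') (a : f ⇒ f') :
  (g' ◁ a) ∘ (b ▷ f) = (b ▷ f') ∘ (g ◁ a).
Proof. by rewrite exch_lr exch_rl. Qed.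

Lemma assoc'_nat (X Y Z T : C) (h h' : Z ⟶ T) (g g' : Y ⟶ Z) (f f' : X ⟶ Y)
    (c : h ⇒ h') (b : g ⇒ g') (a : f ⇒ f') :
  assoc' h' g' f' ∘ (c ⊛ (b ⊛ a)) = ((c ⊛ b) ⊛ a) ∘ assoc' h g f.
Proof.
apply: (cancel_l assocK); apply: (cancel_r assoc'K).
by rewrite !vassoc assocK vidr assoc_nat -!vassoc assoc'K vidl.
Qed.

Lemma lun'_nat (X Y : C) (f f' : X ⟶ Y) (a : f ⇒ f') :
  lun' f' ∘ a = (idA Y ◁ a) ∘ lun' f.
Proof.
apply: (cancel_l lunK); apply: (cancel_r lun'K).
by rewrite !vassoc lunK vidr lun_nat -!vassoc lun'K vidl.
Qed.

Lemma run'_nat (X Y : C) (f f' : X ⟶ Y) (a : f ⇒ f') :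
  run' f' ∘ a = (a ▷ idA X) ∘ run' f.
Proof.
apply: (cancel_l runK); apply: (cancel_r run'K).
by rewrite !vassoc runK vidr run_nat -!vassoc run'K vidl.
Qed.

End Basics.
Arguments assoc'_nat {_ X Y Z T h h' g g' f f' c b a}.
Arguments lun'_nat {_ X Y f f' a}.
Arguments run'_nat {_ X Y f f' a}.
Arguments lwhisk_comp {_ X Y Z r f g h b a}.
Arguments rwhisk_comp {_ X Y Z l f g h b a}.
Arguments exch {_ X Y Z g g' f f' b a}.

Tactic Notation "rw" uconstr(e) :=
  rewrite ?vassoc;
  first [rewrite (post3 e) | rewrite (post2 e) | rewrite e];
  rewrite ?vassoc ?vidl ?vidr.
Tactic Notation "rwb" uconstr(e) :=
  rewrite ?vassoc;
  first [rewrite (post3 (eq_sym e)) | rewrite (post2 (eq_sym e)) | rewrite -e];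
  rewrite ?vassoc ?vidl ?vidr.

Section Coherence.
Variable C : Bicategory.
Variables (X Y Z T U : C).

Lemma lw_assocK (k : T ⟶ U) (h : Z ⟶ T) (g : Y ⟶ Z) (f : X ⟶ Y) :
  (k ◁ assoc' h g f) ∘ (k ◁ assoc h g f) = id2 _.
Proof. by rewrite -lwhisk_comp assocK hcomp_id. Qed.

Lemma lw_assoc'K (k : T ⟶ U) (h : Z ⟶ T) (g : Y ⟶ Z) (f : X ⟶ Y) :
  (k ◁ assoc h g f) ∘ (k ◁ assoc' h g f) = id2 _.
Proof. by rewrite -lwhisk_comp assoc'K hcomp_id. Qed.

Lemma rw_assocK (k : T ⟶ U) (h : Z ⟶ T) (g : Y ⟶ Z) (f : X ⟶ Y) :
  (assoc' k h g ▷ f) ∘ (assoc k h g ▷ f) = id2 _.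
Proof. by rewrite -rwhisk_comp assocK hcomp_id. Qed.

Lemma rw_assoc'K (k : T ⟶ U) (h : Z ⟶ T) (g : Y ⟶ Z) (f : X ⟶ Y) :
  (assoc k h g ▷ f) ∘ (assoc' k h g ▷ f) = id2 _.
Proof. by rewrite -rwhisk_comp assoc'K hcomp_id. Qed.

Arguments lw_assocK {k h g f}.
Arguments lw_assoc'K {k h g f}.
Arguments rw_assocK {k h g f}.
Arguments rw_assoc'K {k h g f}.

Variables (k : T ⟶ U) (h : Z ⟶ T) (g : Y ⟶ Z) (f : X ⟶ Y).

Lemma pent1 :
  assoc (k ⊙ h) g f ∘ (assoc' k h g ▷ f)
  = assoc' k h (g ⊙ f) ∘ ((k ◁ assoc h g f) ∘ assoc k (h ⊙ g) f).
Proof.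
apply: (cancel_l assocK); apply: (cancel_r rw_assoc'K).
by rw rw_assocK; rw assoc'K; rw pentagon.
Qed.

Lemma pent2 :
  assoc k (h ⊙ g) f ∘ ((assoc k h g ▷ f) ∘ assoc' (k ⊙ h) g f)
  = (k ◁ assoc' h g f) ∘ assoc k h (g ⊙ f).
Proof.
apply: (cancel_l lw_assocK).
by rw lw_assoc'K; rw pentagon; rw assoc'K.
Qed.

Lemma pent3 :
  (assoc' k h g ▷ f) ∘ (assoc' k (h ⊙ g) f ∘ (k ◁ assoc' h g f))
  = assoc' (k ⊙ h) g f ∘ assoc' k h (g ⊙ f).
Proof.
apply: (cancel_l assocK); apply: (cancel_l assocK).
by rw assoc'K; rw assoc'K; rw pent1; rw assoc'K; rw assoc'K; rw lw_assoc'K.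
Qed.

Lemma pent4 :
  (assoc k h g ▷ f) ∘ assoc' (k ⊙ h) g f
  = assoc' k (h ⊙ g) f ∘ ((k ◁ assoc' h g f) ∘ assoc k h (g ⊙ f)).
Proof. by rewrite -pent2; rw assocK. Qed.

Lemma pent5 :
  assoc (k ⊙ h) g f ∘ ((assoc' k h g ▷ f) ∘ assoc' k (h ⊙ g) f)
  = assoc' k h (g ⊙ f) ∘ (k ◁ assoc h g f).
Proof. by rw pent1; rw assoc'K. Qed.

Lemma pent6 :
  assoc k (h ⊙ g) f ∘ (assoc k h g ▷ f)
  = (k ◁ assoc' h g f) ∘ (assoc k h (g ⊙ f) ∘ assoc (k ⊙ h) g f).
Proof. by apply: (cancel_l lw_assocK); rw lw_assoc'K; rw pentagon. Qed.
End Coherence.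

Arguments lw_assocK {C X Y Z T U k h g f}.
Arguments lw_assoc'K {C X Y Z T U k h g f}.
Arguments rw_assocK {C X Y Z T U k h g f}.
Arguments rw_assoc'K {C X Y Z T U k h g f}.
Arguments pent1 {C X Y Z T U k h g f}.
Arguments pent2 {C X Y Z T U k h g f}.
Arguments pent3 {C X Y Z T U k h g f}.
Arguments pent4 {C X Y Z T U k h g f}.
Arguments pent5 {C X Y Z T U k h g f}.
Arguments pent6 {C X Y Z T U k h g f}.

Section UnitCoherence.
Variable C : Bicategory.

Lemma lun_inj (X Y : C) (f g : X ⟶ Y) (a b : f ⇒ g) :
  idA Y ◁ a = idA Y ◁ b -> a = b.
Proof.
move=> e; apply: (cancel_r lun'K).
by rewrite -!lun_nat e.
Qed.

Lemma run_inj (X Y : C) (f g : X ⟶ Y) (a b : f ⇒ g) :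
  a ▷ idA X = b ▷ idA X -> a = b.
Proof.
move=> e; apply: (cancel_r run'K).
by rewrite -!run_nat e.
Qed.

Lemma lun_comp (X Y Z : C) (g : Y ⟶ Z) (f : X ⟶ Y) :
  lun (g ⊙ f) ∘ assoc (idA Z) g f = lun g ▷ f.
Proof.
apply: lun_inj; rewrite lwhisk_comp.
apply: (cancel_r assoc'K).
apply: (cancel_r rw_assoc'K).
rw pentagon; rw triangle; rwb assoc_nat.
by rewrite -rwhisk_comp triangle -hcomp_id assoc_nat.
Qed.

Lemma run_comp (X Y Z : C) (g : Y ⟶ Z) (f : X ⟶ Y) :
  (g ◁ run f) ∘ assoc g f (idA X) = run (g ⊙ f).
Proof.
apply: run_inj; rewrite rwhisk_comp.
apply: (cancel_l assocK).
rw assoc_nat; rewrite -(triangle (g := f)) lwhisk_comp.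
rw pentagon; rwb assoc_nat.
by rewrite hcomp_id -triangle.
Qed.

Lemma lun_run (X : C) : lun (idA X) = run (idA X).
Proof.
apply: lun_inj; apply: (cancel_r (assoc'K)).
rewrite run_comp triangle.
apply: (cancel_l runK).
by rewrite run_nat.
Qed.

Arguments lun_comp {X Y Z g f}.
Arguments run_comp {X Y Z g f}.

Lemma rw_runK (X Y Z : C) (g : Y ⟶ Z) (f : X ⟶ Y) :
  (run g ▷ f) ∘ (run' g ▷ f) = id2 _.
Proof. by rewrite -rwhisk_comp run'K hcomp_id. Qed.

Lemma lun'_comp (X Y Z : C) (g : Y ⟶ Z) (f : X ⟶ Y) :
  assoc (idA Z) g f ∘ (lun' g ▷ f) = lun' (g ⊙ f).
Proof.
apply: (cancel_l lunK); rw lun'K; rw lun_comp.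
by rewrite -rwhisk_comp lun'K hcomp_id.
Qed.

Lemma run'_comp (X Y Z : C) (g : Y ⟶ Z) (f : X ⟶ Y) :
  assoc' g f (idA X) ∘ (g ◁ run' f) = run' (g ⊙ f).
Proof.
apply: (cancel_l runK); rewrite run'K -run_comp; rw assoc'K.
by rewrite -lwhisk_comp run'K hcomp_id.
Qed.

Lemma triangle' (X Y Z : C) (g : Y ⟶ Z) (f : X ⟶ Y) :
  assoc' g (idA Y) f ∘ (g ◁ lun' f) = run' g ▷ f.
Proof.
have e : (run' g ▷ f) ∘ (run g ▷ f) = id2 _.
  by rewrite -rwhisk_comp runK hcomp_id.
apply: (cancel_l e); rewrite rw_runK -triangle; rw assoc'K.
by rewrite -lwhisk_comp lun'K hcomp_id.
Qed.

Lemma rw_triangle (X Y Z : C) (g : Y ⟶ Z) (f : X ⟶ Y) :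
  (g ◁ lun f) ∘ (assoc g (idA Y) f ∘ (run' g ▷ f)) = id2 _.
Proof. by rw triangle; apply: rw_runK. Qed.

Lemma lun_comp' (X Y Z : C) (g : Y ⟶ Z) (f : X ⟶ Y) :
  (lun g ▷ f) ∘ assoc' (idA Z) g f = lun (g ⊙ f).
Proof. by rewrite -lun_comp; rw assoc'K. Qed.
End UnitCoherence.
Arguments triangle' {C X Y Z g f}.
Arguments rw_triangle {C X Y Z g f}.
Arguments run_comp {C X Y Z g f}.
Arguments run'_comp {C X Y Z g f}.
Arguments lun_comp {C X Y Z g f}.
Arguments lun_comp' {C X Y Z g f}.
Arguments lun'_comp {C X Y Z g f}.
Arguments rw_runK {C X Y Z g f}.

#[local] Obligation Tactic := idtac.

Section IsoOps.
Variable C : Bicategory.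

Definition iso_id (X Y : C) (f : X ⟶ Y) : iso2 f f :=
  {| fwd := id2 f; bwd := id2 f; fwdK := vidl; bwdK := vidl |}.

Program Definition iso_inv (X Y : C) (f g : X ⟶ Y) (i : iso2 f g) : iso2 g f :=
  {| fwd := bwd i; bwd := i |}.
Next Obligation. by move=> X Y f g i; apply: bwdK. Qed.
Next Obligation. by move=> X Y f g i; apply: fwdK. Qed.

Program Definition iso_comp (X Y : C) (f g h : X ⟶ Y)
    (j : iso2 g h) (i : iso2 f g) : iso2 f h :=
  {| fwd := j ∘ i; bwd := bwd i ∘ bwd j |}.
Next Obligation. by move=> X Y f g h j i; rw fwdK; rw fwdK. Qed.
Next Obligation. by move=> X Y f g h j i; rw bwdK; rw bwdK. Qed.

Program Definition iso_hcomp (X Y Z : C) (g g' : Y ⟶ Z) (f f' : X ⟶ Y)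
    (j : iso2 g g') (i : iso2 f f') : iso2 (g ⊙ f) (g' ⊙ f') :=
  {| fwd := j ⊛ i; bwd := bwd j ⊛ bwd i |}.
Next Obligation.
by move=> X Y Z g g' f f' j i; rewrite -interchange !fwdK hcomp_id.
Qed.
Next Obligation.
by move=> X Y Z g g' f f' j i; rewrite -interchange !bwdK hcomp_id.
Qed.

Definition iso_assoc (X Y Z T : C) (h : Z ⟶ T) (g : Y ⟶ Z) (f : X ⟶ Y) :
    iso2 ((h ⊙ g) ⊙ f) (h ⊙ (g ⊙ f)) :=
  {| fwd := assoc h g f; bwd := assoc' h g f; fwdK := assocK; bwdK := assoc'K |}.

Definition iso_lun (X Y : C) (f : X ⟶ Y) : iso2 (idA Y ⊙ f) f :=
  {| fwd := lun f; bwd := lun' f; fwdK := lunK; bwdK := lun'K |}.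

Definition iso_run (X Y : C) (f : X ⟶ Y) : iso2 (f ⊙ idA X) f :=
  {| fwd := run f; bwd := run' f; fwdK := runK; bwdK := run'K |}.

End IsoOps.

Record Pseudofunctor (C D : Bicategory) := {
  F0 :> C -> D;
  F1 : forall X Y : C, X ⟶ Y -> F0 X ⟶ F0 Y;
  F2 : forall (X Y : C) (f g : X ⟶ Y), f ⇒ g -> F1 f ⇒ F1 g;
  phi : forall (X Y Z : C) (g : Y ⟶ Z) (f : X ⟶ Y),
    iso2 (F1 g ⊙ F1 f) (F1 (g ⊙ f));
  xi : forall X : C, iso2 (idA (F0 X)) (F1 (idA X));
  F2_id : forall (X Y : C) (f : X ⟶ Y), F2 (id2 f) = id2 (F1 f);
  F2_comp : forall (X Y : C) (f g h : X ⟶ Y) (b : g ⇒ h) (a : f ⇒ g),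
    F2 (b ∘ a) = F2 b ∘ F2 a;
  phi_nat : forall (X Y Z : C) (g g' : Y ⟶ Z) (f f' : X ⟶ Y)
      (b : g ⇒ g') (a : f ⇒ f'),
    F2 (b ⊛ a) ∘ phi g f = phi g' f' ∘ (F2 b ⊛ F2 a);
  phi_assoc : forall (X Y Z T : C) (h : Z ⟶ T) (g : Y ⟶ Z) (f : X ⟶ Y),
    F2 (assoc h g f) ∘ (phi (h ⊙ g) f ∘ (phi h g ▷ F1 f))
    = phi h (g ⊙ f) ∘ ((F1 h ◁ phi g f) ∘ assoc (F1 h) (F1 g) (F1 f));
  phi_lun : forall (X Y : C) (f : X ⟶ Y),
    F2 (lun f) ∘ (phi (idA Y) f ∘ (xi Y ▷ F1 f)) = lun (F1 f);
  phi_run : forall (X Y : C) (f : X ⟶ Y),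
    F2 (run f) ∘ (phi f (idA X) ∘ (F1 f ◁ xi X)) = run (F1 f)
}.

Arguments F1 {C D} p {X Y} f : rename.
Arguments F2 {C D} p {X Y f g} a : rename.
Arguments phi {C D} p {X Y Z} g f : rename.
Arguments xi {C D} p X : rename.
Arguments F2_id {C D p X Y f} : rename.
Arguments F2_comp {C D p X Y f g h b a} : rename.
Arguments phi_nat {C D p X Y Z g g' f f' b a} : rename.
Arguments phi_assoc {C D p X Y Z T h g f} : rename.
Arguments phi_lun {C D p X Y f} : rename.
Arguments phi_run {C D p X Y f} : rename.

Program Definition iso_map (C D : Bicategory) (F : Pseudofunctor C D) (X Y : C)
    (f g : X ⟶ Y) (i : iso2 f g) : iso2 (F1 F f) (F1 F g) :=
  {| fwd := F2 F i; bwd := F2 F (bwd i) |}.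
Next Obligation. by move=> C D F X Y f g i; rewrite -F2_comp fwdK F2_id. Qed.
Next Obligation. by move=> C D F X Y f g i; rewrite -F2_comp bwdK F2_id. Qed.

Definition cell_of_eq (C : Bicategory) (X Y : C) (f g : X ⟶ Y) (p : f = g) :
    f ⇒ g :=
  match p with eq_refl => id2 f end.

(* A 2-functor preserves composites and identities of arrows on the nose, and
   its structural 2-cells are the identities, transported along these
   equalities. *)
Definition is_2functor (C D : Bicategory) (F : Pseudofunctor C D) : Prop :=
  (forall (X Y Z : C) (g : Y ⟶ Z) (f : X ⟶ Y),
     exists p : F1 F g ⊙ F1 F f = F1 F (g ⊙ f), fwd (phi F g f) = cell_of_eq p)
  /\ (forall X : C,
     exists p : idA (F X) = F1 F (idA X), fwd (xi F X) = cell_of_eq p).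

Program Definition idPF (C : Bicategory) : Pseudofunctor C C :=
  {| F0 := fun X => X;
     F1 := fun X Y f => f;
     F2 := fun X Y f g a => a;
     phi := fun X Y Z g f => iso_id (g ⊙ f);
     xi := fun X => iso_id (idA X) |}.
Next Obligation. by []. Qed.
Next Obligation. by []. Qed.
Next Obligation. by move=> *; rewrite /= vidl vidr. Qed.
Next Obligation. by move=> *; rewrite /= !hcomp_id !vidl !vidr. Qed.
Next Obligation. by move=> *; rewrite /= !hcomp_id !vidr. Qed.
Next Obligation. by move=> *; rewrite /= !hcomp_id !vidr. Qed.

Program Definition compPF (C D E : Bicategory) (G : Pseudofunctor D E)
    (F : Pseudofunctor C D) : Pseudofunctor C E :=
  {| F0 := fun X => G (F X);
     F1 := fun X Y f => F1 G (F1 F f);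
     F2 := fun X Y f g a => F2 G (F2 F a);
     phi := fun X Y Z g f =>
       iso_comp (iso_map G (phi F g f)) (phi G (F1 F g) (F1 F f));
     xi := fun X => iso_comp (iso_map G (xi F X)) (xi G (F X)) |}.
Next Obligation. by move=> *; rewrite /= !F2_id. Qed.
Next Obligation. by move=> *; rewrite /= !F2_comp. Qed.
Next Obligation.
move=> C D E G F X Y Z g g' f f' b a /=.
by rwb F2_comp; rewrite phi_nat F2_comp; rw phi_nat.
Qed.
Next Obligation.
move=> C D E G F X Y Z T h g f /=.
rewrite rwhisk_comp lwhisk_comp.
rewrite -F2_id; rwb phi_nat; rewrite F2_id.
rwb F2_comp; rwb F2_comp; rewrite phi_assoc !F2_comp.
by rw phi_assoc; rw phi_nat; rewrite F2_id.
Qed.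
Next Obligation.
move=> C D E G F X Y f /=.
rewrite rwhisk_comp.
rewrite -F2_id; rwb phi_nat; rewrite F2_id.
by rwb F2_comp; rwb F2_comp; rewrite phi_lun phi_lun.
Qed.
Next Obligation.
move=> C D E G F X Y f /=.
rewrite lwhisk_comp.
rewrite -F2_id; rwb phi_nat; rewrite F2_id.
by rwb F2_comp; rwb F2_comp; rewrite phi_run phi_run.
Qed.

Record Pseudonat (C D : Bicategory) (F G : Pseudofunctor C D) := {
  pn0 :> forall X : C, F X ⟶ G X;
  pn1 : forall (X Y : C) (f : X ⟶ Y), iso2 (F1 G f ⊙ pn0 X) (pn0 Y ⊙ F1 F f);
  pn_nat : forall (X Y : C) (f g : X ⟶ Y) (a : f ⇒ g),
    (pn0 Y ◁ F2 F a) ∘ pn1 f = pn1 g ∘ (F2 G a ▷ pn0 X);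
  pn_comp : forall (X Y Z : C) (g : Y ⟶ Z) (f : X ⟶ Y),
    pn1 (g ⊙ f) ∘ (phi G g f ▷ pn0 X)
    = (pn0 Z ◁ phi F g f)
      ∘ (assoc (pn0 Z) (F1 F g) (F1 F f)
      ∘ ((pn1 g ▷ F1 F f)
      ∘ (assoc' (F1 G g) (pn0 Y) (F1 F f)
      ∘ ((F1 G g ◁ pn1 f)
      ∘ assoc (F1 G g) (F1 G f) (pn0 X)))));
  pn_id : forall X : C,
    pn1 (idA X) ∘ (xi G X ▷ pn0 X)
    = (pn0 X ◁ xi F X) ∘ (run' (pn0 X) ∘ lun (pn0 X))
}.

Arguments pn1 {C D F G} p {X Y} f : rename.
Arguments pn_nat {C D F G p X Y f g a} : rename.
Arguments pn_comp {C D F G p X Y Z g f} : rename.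
Arguments pn_id {C D F G p X} : rename.

Record Modification (C D : Bicategory) (F G : Pseudofunctor C D)
    (σ τ : Pseudonat F G) := {
  md0 :> forall X : C, σ X ⇒ τ X;
  md_nat : forall (X Y : C) (f : X ⟶ Y),
    (md0 Y ▷ F1 F f) ∘ pn1 σ f = pn1 τ f ∘ (F1 G f ◁ md0 X)
}.
Arguments md_nat {C D F G σ τ m X Y f} : rename.

Section Hom.
Variables C D : Bicategory.

Lemma mod_ext (F G : Pseudofunctor C D) (σ τ : Pseudonat F G)
    (m n : Modification σ τ) : (forall X, m X = n X) -> m = n.
Proof.
case: m n => [m mn] [n nn] /= e.
have e' : m = n by apply: functional_extensionality_dep.
by subst n; f_equal; apply: proof_irrelevance.
Qed.

Program Definition pn_idt (F : Pseudofunctor C D) : Pseudonat F F :=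
  {| pn0 := fun X => idA (F X);
     pn1 := fun X Y f => iso_comp (iso_inv (iso_lun (F1 F f))) (iso_run (F1 F f)) |}.
Next Obligation.
move=> F X Y f g a /=.
by rwb lun'_nat; rw run_nat.
Qed.
Next Obligation.
move=> F X Y Z g f /=.
rw run_nat; rw lun'_nat; congr (_ ∘ _).
rewrite lwhisk_comp !rwhisk_comp.
rw run_comp; rw lun'_comp; rw triangle'.
by rw rw_runK.
Qed.
Next Obligation.
move=> F X /=.
by rw run_nat; rw lun'_nat; rewrite lun_run; congr (_ ∘ _);
  apply: (cancel_l runK); rewrite -{1}lun_run; rw lun'K; rw run'K.
Qed.

Lemma pn_comp_coh (X1 Y1 Z1 X2 Y2 Z2 X3 Y3 Z3 : D)
  (s : X1 ⟶ X2) (s' : Y1 ⟶ Y2) (s'' : Z1 ⟶ Z2)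
  (t : X2 ⟶ X3) (t' : Y2 ⟶ Y3) (t'' : Z2 ⟶ Z3)
  (f1 : X1 ⟶ Y1) (g1 : Y1 ⟶ Z1) (f2 : X2 ⟶ Y2) (g2 : Y2 ⟶ Z2)
  (f3 : X3 ⟶ Y3) (g3 : Y3 ⟶ Z3)
  (σf : f2 ⊙ s ⇒ s' ⊙ f1) (σg : g2 ⊙ s' ⇒ s'' ⊙ g1)
  (τf : f3 ⊙ t ⇒ t' ⊙ f2) (τg : g3 ⊙ t' ⇒ t'' ⊙ g2) :
  assoc' t'' s'' (g1 ⊙ f1) ∘ ((t'' ◁ (assoc s'' g1 f1 ∘ ((σg ▷ f1) ∘
    (assoc' g2 s' f1 ∘ ((g2 ◁ σf) ∘ assoc g2 f2 s))))) ∘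
    (assoc t'' (g2 ⊙ f2) s ∘ (((assoc t'' g2 f2 ∘ ((τg ▷ f2) ∘
    (assoc' g3 t' f2 ∘ ((g3 ◁ τf) ∘ assoc g3 f3 t)))) ▷ s) ∘
    assoc' (g3 ⊙ f3) t s)))
  = assoc (t'' ⊙ s'') g1 f1 ∘
    (((assoc' t'' s'' g1 ∘ ((t'' ◁ σg) ∘ (assoc t'' g2 s' ∘ ((τg ▷ s') ∘
       assoc' g3 t' s')))) ▷ f1) ∘
    (assoc' g3 (t' ⊙ s') f1 ∘
    ((g3 ◁ (assoc' t' s' f1 ∘ ((t' ◁ σf) ∘ (assoc t' f2 s ∘ ((τf ▷ s) ∘
       assoc' f3 t s))))) ∘
    assoc g3 f3 (t ⊙ s)))).
Proof.
rewrite !lwhisk_comp !rwhisk_comp.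
rw pentagon.
rw assoc_nat; rewrite hcomp_id.
rw pent1.
rw assoc_nat.
rw pent2.
rewrite -!vassoc; do 4! [congr (_ ∘ _)]; rewrite !vassoc.
rwb assoc_nat; rewrite hcomp_id; rw exch.
rewrite -(hcomp_id (g := g3) (f := t')); rwb assoc'_nat.
rewrite -!vassoc; congr (_ ∘ _); rewrite !vassoc.
rw pent3; rwb assoc'_nat; rewrite hcomp_id.
rewrite -!vassoc; do 2! [congr (_ ∘ _)]; rewrite !vassoc.
rw pent4; rwb assoc'_nat; rw pent5.
by [].
Qed.

Program Definition pn_vcomp (F G H : Pseudofunctor C D) (τ : Pseudonat G H)
    (σ : Pseudonat F G) : Pseudonat F H :=
  {| pn0 := fun X => τ X ⊙ σ X;
     pn1 := fun X Y f =>
       iso_comp (iso_inv (iso_assoc (τ Y) (σ Y) (F1 F f)))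
      (iso_comp (iso_hcomp (iso_id (τ Y)) (pn1 σ f))
      (iso_comp (iso_assoc (τ Y) (F1 G f) (σ X))
      (iso_comp (iso_hcomp (pn1 τ f) (iso_id (σ X)))
                (iso_inv (iso_assoc (F1 H f) (τ X) (σ X)))))) |}.
Next Obligation.
move=> F G H τ σ X Y f g a /=.
rewrite -hcomp_id; rwb assoc'_nat.
rwb lwhisk_comp; rewrite pn_nat lwhisk_comp.
rwb assoc_nat; rwb rwhisk_comp; rewrite pn_nat rwhisk_comp.
by rewrite -hcomp_id; rw assoc'_nat.
Qed.
Next Obligation.
move=> F G H τ σ X Y Z g f /=.
rewrite -pn_comp_coh.
rewrite -2!hcomp_id; rw assoc'_nat.
rwb rwhisk_comp; rewrite pn_comp rwhisk_comp.
rw assoc_nat.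
rwb lwhisk_comp; rewrite pn_comp lwhisk_comp.
by rw assoc'_nat.
Qed.
Next Obligation.
move=> F G H τ σ X /=.
rewrite -hcomp_id; rw assoc'_nat.
rwb rwhisk_comp; rewrite pn_id !rwhisk_comp.
rw assoc_nat.
rwb lwhisk_comp; rewrite pn_id !lwhisk_comp.
rw assoc'_nat; congr (_ ∘ _).
by rw run'_comp; rw rw_triangle; rw lun_comp'.
Qed.

Program Definition md_id (F G : Pseudofunctor C D) (σ : Pseudonat F G) :
    Modification σ σ :=
  {| md0 := fun X => id2 (σ X) |}.
Next Obligation. by move=> *; rewrite !hcomp_id vidl vidr. Qed.

Program Definition md_vcomp (F G : Pseudofunctor C D) (σ τ υ : Pseudonat F G)
    (n : Modification τ υ) (m : Modification σ τ) : Modification σ υ :=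
  {| md0 := fun X => n X ∘ m X |}.
Next Obligation.
move=> F G σ τ υ n m X Y f /=.
by rewrite rwhisk_comp lwhisk_comp; rw md_nat; rw md_nat.
Qed.

Program Definition md_hcomp (F G H : Pseudofunctor C D) (τ τ' : Pseudonat G H)
    (σ σ' : Pseudonat F G) (n : Modification τ τ') (m : Modification σ σ') :
    Modification (pn_vcomp τ σ) (pn_vcomp τ' σ') :=
  {| md0 := fun X => n X ⊛ m X |}.
Next Obligation.
move=> F G H τ τ' σ σ' n m X Y f /=.
rwb assoc'_nat; rwb interchange; rewrite md_nat.
rewrite -{1}(vidl (a := n Y)) interchange.
rwb assoc_nat; rwb interchange; rewrite md_nat.
rewrite -{1}(vidl (a := m X)) interchange.
by rw assoc'_nat.
Qed.

Program Definition md_inv (F G : Pseudofunctor C D) (σ τ : Pseudonat F G)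
    (m : Modification σ τ) (n : forall X, τ X ⇒ σ X)
    (nm : forall X, n X ∘ m X = id2 (σ X)) (mn : forall X, m X ∘ n X = id2 (τ X)) :
    Modification τ σ :=
  {| md0 := n |}.
Next Obligation.
move=> F G σ τ m n nm mn X Y f /=.
have e : (n Y ▷ F1 F f) ∘ (m Y ▷ F1 F f) = id2 _.
  by rewrite -rwhisk_comp nm hcomp_id.
have e' : (F1 G f ◁ m X) ∘ (F1 G f ◁ n X) = id2 _.
  by rewrite -lwhisk_comp mn hcomp_id.
apply: (cancel_r e'); rwb md_nat; rw e.
by rewrite -lwhisk_comp nm hcomp_id vidr.
Qed.

Program Definition md_assoc (F G H K : Pseudofunctor C D) (υ : Pseudonat H K)
    (τ : Pseudonat G H) (σ : Pseudonat F G) :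
    Modification (pn_vcomp (pn_vcomp υ τ) σ) (pn_vcomp υ (pn_vcomp τ σ)) :=
  {| md0 := fun X => assoc (υ X) (τ X) (σ X) |}.
Next Obligation.
move=> F G H K υ τ σ X Y f /=.
rewrite !lwhisk_comp !rwhisk_comp.
rw pent4; rewrite -hcomp_id; rw assoc_nat.
rw pent1; rw assoc'K; rw assoc_nat.
rw pent6; rw assoc_nat; rw pent5.
by rewrite hcomp_id.
Qed.

Program Definition md_lun (F G : Pseudofunctor C D) (σ : Pseudonat F G) :
    Modification (pn_vcomp (pn_idt G) σ) σ :=
  {| md0 := fun X => lun (σ X) |}.
Next Obligation.
move=> F G σ X Y f /=.
rewrite !rwhisk_comp.
rw lun_comp'; rw lun_nat; rw lun_comp.
have e : (lun (F1 G f) ▷ σ X) ∘ (lun' (F1 G f) ▷ σ X) = id2 _.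
  by rewrite -rwhisk_comp lun'K hcomp_id.
by rw e; rewrite -triangle; rw assoc'K.
Qed.

Program Definition md_run (F G : Pseudofunctor C D) (σ : Pseudonat F G) :
    Modification (pn_vcomp σ (pn_idt F)) σ :=
  {| md0 := fun X => run (σ X) |}.
Next Obligation.
move=> F G σ X Y f /=.
rewrite !lwhisk_comp.
rw triangle'; rw rw_runK; rw run_comp; rw run_nat.
by rewrite -run_comp; rw assoc'K.
Qed.

Definition md_assoc' (F G H K : Pseudofunctor C D) (υ : Pseudonat H K)
    (τ : Pseudonat G H) (σ : Pseudonat F G) :=
  md_inv (m := md_assoc υ τ σ) (n := fun X => assoc' (υ X) (τ X) (σ X))
    (fun X => assocK) (fun X => assoc'K).

Definition md_lun' (F G : Pseudofunctor C D) (σ : Pseudonat F G) :=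
  md_inv (m := md_lun σ) (n := fun X => lun' (σ X))
    (fun X => lunK) (fun X => lun'K).

Definition md_run' (F G : Pseudofunctor C D) (σ : Pseudonat F G) :=
  md_inv (m := md_run σ) (n := fun X => run' (σ X))
    (fun X => runK) (fun X => run'K).

Program Definition Hom : Bicategory :=
  {| ob := Pseudofunctor C D;
     arr := @Pseudonat C D;
     cell := @Modification C D;
     idA := pn_idt;
     compA := pn_vcomp;
     id2 := md_id;
     vcomp := md_vcomp;
     hcomp := md_hcomp;
     assoc := md_assoc;
     assoc' := md_assoc';
     lun := md_lun;
     lun' := md_lun';
     run := md_run;
     run' := md_run' |}.
Next Obligation. by move=> *; apply: mod_ext => X /=; apply: vassoc. Qed.
Next Obligation. by move=> *; apply: mod_ext => X /=; apply: vidl. Qed.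
Next Obligation. by move=> *; apply: mod_ext => X /=; apply: vidr. Qed.
Next Obligation. by move=> *; apply: mod_ext => X /=; apply: hcomp_id. Qed.
Next Obligation. by move=> *; apply: mod_ext => X /=; apply: interchange. Qed.
Next Obligation. by move=> *; apply: mod_ext => X /=; apply: assoc_nat. Qed.
Next Obligation. by move=> *; apply: mod_ext => X /=; apply: lun_nat. Qed.
Next Obligation. by move=> *; apply: mod_ext => X /=; apply: run_nat. Qed.
Next Obligation. by move=> *; apply: mod_ext => X /=; apply: assocK. Qed.
Next Obligation. by move=> *; apply: mod_ext => X /=; apply: assoc'K. Qed.
Next Obligation. by move=> *; apply: mod_ext => X /=; apply: lunK. Qed.
Next Obligation. by move=> *; apply: mod_ext => X /=; apply: lun'K. Qed.
Next Obligation. by move=> *; apply: mod_ext => X /=; apply: runK. Qed.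
Next Obligation. by move=> *; apply: mod_ext => X /=; apply: run'K. Qed.
Next Obligation. by move=> *; apply: mod_ext => X /=; apply: pentagon. Qed.
Next Obligation. by move=> *; apply: mod_ext => X /=; apply: triangle. Qed.
End Hom.

Program Definition Full (B : Bicategory) (P : B -> Prop) : Bicategory :=
  {| ob := {X : B | P X};
     arr := fun X Y => proj1_sig X ⟶ proj1_sig Y;
     cell := fun X Y f g => f ⇒ g;
     idA := fun X => idA (proj1_sig X);
     compA := fun X Y Z g f => g ⊙ f;
     id2 := fun X Y f => id2 f;
     vcomp := fun X Y f g h b a => b ∘ a;
     hcomp := fun X Y Z g g' f f' b a => b ⊛ a;
     assoc := fun X Y Z T h g f => assoc h g f;
     assoc' := fun X Y Z T h g f => assoc' h g f;
     lun := fun X Y f => lun f;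
     lun' := fun X Y f => lun' f;
     run := fun X Y f => run f;
     run' := fun X Y f => run' f |}.
Next Obligation. by move=> *; apply: vassoc. Qed.
Next Obligation. by move=> *; apply: vidl. Qed.
Next Obligation. by move=> *; apply: vidr. Qed.
Next Obligation. by move=> *; apply: hcomp_id. Qed.
Next Obligation. by move=> *; apply: interchange. Qed.
Next Obligation. by move=> *; apply: assoc_nat. Qed.
Next Obligation. by move=> *; apply: lun_nat. Qed.
Next Obligation. by move=> *; apply: run_nat. Qed.
Next Obligation. by move=> *; apply: assocK. Qed.
Next Obligation. by move=> *; apply: assoc'K. Qed.
Next Obligation. by move=> *; apply: lunK. Qed.
Next Obligation. by move=> *; apply: lun'K. Qed.
Next Obligation. by move=> *; apply: runK. Qed.
Next Obligation. by move=> *; apply: run'K. Qed.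
Next Obligation. by move=> *; apply: pentagon. Qed.
Next Obligation. by move=> *; apply: triangle. Qed.

Program Definition corestrict (A B : Bicategory) (P : B -> Prop)
    (F : Pseudofunctor A B) (hF : forall X : A, P (F X)) :
    Pseudofunctor A (Full P) :=
  {| F0 := fun X => exist P (F X) (hF X);
     F1 := fun X Y f => F1 F f;
     F2 := fun X Y f g a => F2 F a;
     phi := fun X Y Z g f =>
       {| fwd := fwd (phi F g f); bwd := bwd (phi F g f);
          fwdK := fwdK (i := phi F g f); bwdK := bwdK (i := phi F g f) |};
     xi := fun X =>
       {| fwd := fwd (xi F X); bwd := bwd (xi F X);
          fwdK := fwdK (i := xi F X); bwdK := bwdK (i := xi F X) |} |}.
Next Obligation. by move=> *; apply: F2_id. Qed.
Next Obligation. by move=> *; apply: F2_comp. Qed.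
Next Obligation. by move=> *; apply: phi_nat. Qed.
Next Obligation. by move=> *; apply: phi_assoc. Qed.
Next Obligation. by move=> *; apply: phi_lun. Qed.
Next Obligation. by move=> *; apply: phi_run. Qed.

Section Precomp.
Variables (C E : Bicategory) (i : Pseudofunctor C E) (D : Bicategory).

Program Definition pn_pre (F G : Pseudofunctor E D) (σ : Pseudonat F G) :
    Pseudonat (compPF F i) (compPF G i) :=
  {| pn0 := fun X => σ (i X);
     pn1 := fun X Y f => pn1 σ (F1 i f) |}.
Next Obligation. by move=> F G σ X Y f g a /=; apply: pn_nat. Qed.
Next Obligation.
move=> F G σ X Y Z g f /=.
by rewrite rwhisk_comp lwhisk_comp; rwb pn_nat; rewrite pn_comp ?vassoc.
Qed.
Next Obligation.
move=> F G σ X /=.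
by rewrite rwhisk_comp lwhisk_comp; rwb pn_nat; rewrite pn_id ?vassoc.
Qed.

Program Definition md_pre (F G : Pseudofunctor E D) (σ τ : Pseudonat F G)
    (m : Modification σ τ) : Modification (pn_pre σ) (pn_pre τ) :=
  {| md0 := fun X => m (i X) |}.
Next Obligation. by move=> F G σ τ m X Y f /=; apply: md_nat. Qed.

(* Precomposition with [i] preserves composites and identities of pseudonatural
   transformations; its structural modifications have identity components. *)
Program Definition pre_phi (F G H : Pseudofunctor E D)
    (τ : Pseudonat G H) (σ : Pseudonat F G) :
    iso2 (C := Hom C D) (pn_vcomp (pn_pre τ) (pn_pre σ)) (pn_pre (pn_vcomp τ σ)) :=
  {| fwd := {| md0 := fun X => id2 (τ (i X) ⊙ σ (i X)) |};
     bwd := {| md0 := fun X => id2 (τ (i X) ⊙ σ (i X)) |} |}.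
Next Obligation. by move=> *; rewrite /= !hcomp_id vidl vidr. Qed.
Next Obligation. by move=> *; rewrite /= !hcomp_id vidl vidr. Qed.
Next Obligation. by move=> *; apply: mod_ext => X /=; apply: vidl. Qed.
Next Obligation. by move=> *; apply: mod_ext => X /=; apply: vidl. Qed.

Program Definition pre_xi (F : Pseudofunctor E D) :
    iso2 (C := Hom C D) (pn_idt (compPF F i)) (pn_pre (pn_idt F)) :=
  {| fwd := {| md0 := fun X => id2 (idA (F (i X))) |};
     bwd := {| md0 := fun X => id2 (idA (F (i X))) |} |}.
Next Obligation. by move=> *; rewrite /= !hcomp_id vidl vidr. Qed.
Next Obligation. by move=> *; rewrite /= !hcomp_id vidl vidr. Qed.
Next Obligation. by move=> *; apply: mod_ext => X /=; apply: vidl. Qed.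
Next Obligation. by move=> *; apply: mod_ext => X /=; apply: vidl. Qed.

Program Definition precomp : Pseudofunctor (Hom E D) (Hom C D) :=
  {| F0 := fun F : Hom E D => compPF F i : Hom C D;
     F1 := fun F G σ => pn_pre σ : @arr (Hom C D) (compPF F i) (compPF G i);
     F2 := fun F G σ τ m => md_pre m;
     phi := fun F G H τ σ => pre_phi τ σ;
     xi := fun F => pre_xi F |}.
Next Obligation. by move=> *; apply: mod_ext. Qed.
Next Obligation. by move=> *; apply: mod_ext. Qed.
Next Obligation.
by move=> *; apply: mod_ext => X /=; rewrite vidl vidr.
Qed.
Next Obligation.
by move=> *; apply: mod_ext => X /=; rewrite !hcomp_id !vidl !vidr.
Qed.
Next Obligation.
by move=> *; apply: mod_ext => X /=; rewrite !hcomp_id !vidr.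
Qed.
Next Obligation.
by move=> *; apply: mod_ext => X /=; rewrite !hcomp_id !vidr.
Qed.

End Precomp.

Definition isomorphic (C : Bicategory) (X Y : C) (f g : X ⟶ Y) : Prop :=
  inhabited (iso2 f g).

Definition arrow_family (C : Bicategory) := forall X Y : C, X ⟶ Y -> Prop.

Definition equivalence (C : Bicategory) : arrow_family C := fun X Y f =>
  exists g : Y ⟶ X, isomorphic (g ⊙ f) (idA X) /\ isomorphic (f ⊙ g) (idA Y).

Definition quasiequivalence (C : Bicategory) : arrow_family C := fun X Y f =>
  (forall (Z : C) (a b : Z ⟶ X) (β : f ⊙ a ⇒ f ⊙ b),
     exists! α : a ⇒ b, f ◁ α = β)
  /\ (forall (Z : C) (a b : Y ⟶ Z) (β : a ⊙ f ⇒ b ⊙ f),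
     exists! α : a ⇒ b, α ▷ f = β).

Definition maps_to (C D : Bicategory) (W : arrow_family C) (Γ : arrow_family D)
    (F : Pseudofunctor C D) : Prop :=
  forall (X Y : C) (f : X ⟶ Y), W X Y f -> Γ (F X) (F Y) (F1 F f).

Lemma maps_to_comp (C E D : Bicategory) (W : arrow_family C)
    (i : Pseudofunctor C E) (F : Pseudofunctor E D) :
  maps_to W (@equivalence E) i -> maps_to W (@equivalence D) (compPF F i).
Proof.
move=> hi X Y f /hi[g [[p] [q]]]; exists (F1 F g); split; constructor.
- exact: iso_comp (iso_inv (xi F _)) (iso_comp (iso_map F p) (phi F _ _)).
- exact: iso_comp (iso_inv (xi F _)) (iso_comp (iso_map F q) (phi F _ _)).
Qed.

Definition HomW (C : Bicategory) (W : arrow_family C) (D : Bicategory) : Bicategory :=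
  Full (B := Hom C D) (maps_to W (@equivalence D)).

Definition precompW (C E : Bicategory) (W : arrow_family C) (i : Pseudofunctor C E)
    (hi : maps_to W (@equivalence E) i) (D : Bicategory) :
    Pseudofunctor (Hom E D) (HomW W D) :=
  corestrict (F := precomp i D) (fun F => @maps_to_comp C E D W i F hi).

Definition is_isomorphism (A B : Bicategory) (F : Pseudofunctor A B) : Prop :=
  exists G : Pseudofunctor B A, compPF G F = idPF A /\ compPF F G = idPF B.

Definition strict_localization (C E : Bicategory) (W : arrow_family C)
    (i : Pseudofunctor C E) : Prop :=
  exists hi : maps_to W (@equivalence E) i,
    forall D : Bicategory, is_isomorphism (precompW hi D).

Section Pullback.
Variables (C D : Bicategory) (F : Pseudofunctor C D).

Lemma F2_hcomp (X Y Z : C) (g g' : Y ⟶ Z) (f f' : X ⟶ Y) (b : g ⇒ g') (a : f ⇒ f') :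
  phi F g' f' ∘ ((F2 F b ⊛ F2 F a) ∘ bwd (phi F g f)) = F2 F (b ⊛ a).
Proof. by rwb phi_nat; rw bwdK. Qed.

Lemma phi_assoc' (X Y Z T : C) (h : Z ⟶ T) (g : Y ⟶ Z) (f : X ⟶ Y) :
  F2 F (assoc h g f) ∘ phi F (h ⊙ g) f
  = phi F h (g ⊙ f) ∘ ((F1 F h ◁ phi F g f) ∘
     (assoc (F1 F h) (F1 F g) (F1 F f) ∘ (bwd (phi F h g) ▷ F1 F f))).
Proof.
have e : (phi F h g ▷ F1 F f) ∘ (bwd (phi F h g) ▷ F1 F f) = id2 _.
  by rewrite -rwhisk_comp bwdK hcomp_id.
have e' : (bwd (phi F h g) ▷ F1 F f) ∘ (phi F h g ▷ F1 F f) = id2 _.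
  by rewrite -rwhisk_comp fwdK hcomp_id.
by apply: (cancel_r e); rw phi_assoc; rw e'.
Qed.

Lemma F2_assoc (X Y Z T : C) (h : Z ⟶ T) (g : Y ⟶ Z) (f : X ⟶ Y) :
  F2 F (assoc h g f)
  = phi F h (g ⊙ f) ∘ ((F1 F h ◁ phi F g f) ∘
     (assoc (F1 F h) (F1 F g) (F1 F f) ∘ ((bwd (phi F h g) ▷ F1 F f) ∘
      bwd (phi F (h ⊙ g) f)))).
Proof. by apply: (cancel_r (bwdK (i := phi F (h ⊙ g) f))); rw fwdK; rewrite phi_assoc'. Qed.

Lemma phi_lun' (X Y : C) (f : X ⟶ Y) :
  F2 F (lun f) ∘ phi F (idA Y) f = lun (F1 F f) ∘ (bwd (xi F Y) ▷ F1 F f).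
Proof.
rewrite -phi_lun; rewrite !vassoc -rwhisk_comp bwdK hcomp_id.
by rewrite vidr.
Qed.

Lemma phi_run' (X Y : C) (f : X ⟶ Y) :
  F2 F (run f) ∘ phi F f (idA X) = run (F1 F f) ∘ (F1 F f ◁ bwd (xi F X)).
Proof.
rewrite -phi_run; rewrite !vassoc -lwhisk_comp bwdK hcomp_id.
by rewrite vidr.
Qed.

Arguments phi_lun' {X Y f}.
Arguments phi_run' {X Y f}.

(* The arrows of [C] with the 2-cells of [D] between their images. *)
Program Definition pullback : Bicategory :=
  {| ob := C;
     arr := fun X Y => X ⟶ Y;
     cell := fun X Y f g => F1 F f ⇒ F1 F g;
     idA := fun X => idA X;
     compA := fun X Y Z g f => g ⊙ f;
     id2 := fun X Y f => id2 (F1 F f);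
     vcomp := fun X Y f g h b a => b ∘ a;
     hcomp := fun X Y Z g g' f f' b a =>
       phi F g' f' ∘ ((b ⊛ a) ∘ bwd (phi F g f));
     assoc := fun X Y Z T h g f => F2 F (assoc h g f);
     assoc' := fun X Y Z T h g f => F2 F (assoc' h g f);
     lun := fun X Y f => F2 F (lun f);
     lun' := fun X Y f => F2 F (lun' f);
     run := fun X Y f => F2 F (run f);
     run' := fun X Y f => F2 F (run' f) |}.
Next Obligation. by move=> *; apply: vassoc. Qed.
Next Obligation. by move=> *; apply: vidl. Qed.
Next Obligation. by move=> *; apply: vidr. Qed.
Next Obligation. by move=> *; rewrite /= hcomp_id vidl bwdK. Qed.
Next Obligation.
by move=> *; rewrite /= interchange; rw fwdK.
Qed.
Next Obligation.
move=> X Y Z T h h' g g' f f' c b a /=.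
rewrite !F2_assoc !vassoc; rw fwdK; rw fwdK.
rwb interchange; rwb interchange; rw fwdK; rw fwdK.
rewrite -{1}(vidr (a := a)) interchange; rw assoc_nat.
by rewrite -{2}(vidl (a := c)) interchange; rewrite !vassoc.
Qed.
Next Obligation.
move=> X Y f f' a /=.
rw phi_lun'; rwb interchange.
have e : bwd (xi F Y) ⊛ a = (idA (F Y) ◁ a) ∘ (bwd (xi F Y) ▷ F1 F f).
  by rewrite -interchange vidl vidr.
by rewrite e; rw lun_nat; rwb phi_lun'; rw bwdK.
Qed.
Next Obligation.
move=> X Y f f' a /=.
rw phi_run'; rwb interchange.
have e : a ⊛ bwd (xi F X) = (a ▷ idA (F X)) ∘ (F1 F f ◁ bwd (xi F X)).
  by rewrite -interchange vidl vidr.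
by rewrite e; rw run_nat; rwb phi_run'; rw bwdK.
Qed.
Next Obligation. by move=> *; rewrite /= -F2_comp assocK F2_id. Qed.
Next Obligation. by move=> *; rewrite /= -F2_comp assoc'K F2_id. Qed.
Next Obligation. by move=> *; rewrite /= -F2_comp lunK F2_id. Qed.
Next Obligation. by move=> *; rewrite /= -F2_comp lun'K F2_id. Qed.
Next Obligation. by move=> *; rewrite /= -F2_comp runK F2_id. Qed.
Next Obligation. by move=> *; rewrite /= -F2_comp run'K F2_id. Qed.
Next Obligation.
by move=> *; rewrite /= -!F2_id !F2_hcomp -!F2_comp pentagon.
Qed.
Next Obligation.
by move=> *; rewrite /= -!F2_id !F2_hcomp -!F2_comp triangle.
Qed.

Lemma F2_hcompB (X Y Z : C) (g g' : Y ⟶ Z) (f f' : X ⟶ Y) (b : g ⇒ g') (a : f ⇒ f') :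
  F2 F (b ⊛ a) = @hcomp pullback X Y Z g g' f f' (F2 F b) (F2 F a).
Proof. by rewrite -F2_hcomp. Qed.

End Pullback.

Lemma lwhisk_aux (B : Bicategory) (X Y Y' K : B) (r : Y ⟶ Y') (h : K ⟶ Y)
    (d0 d1 : X ⟶ K) (f g : X ⟶ Y) (e : h ⊙ d1 ⇒ g) (c : d0 ⇒ d1) (n : f ⇒ h ⊙ d0) :
  ((r ◁ e) ∘ assoc r h d1) ∘ (((r ⊙ h) ◁ c) ∘ (assoc' r h d0 ∘ (r ◁ n)))
  = r ◁ (e ∘ ((h ◁ c) ∘ n)).
Proof.
by rewrite -hcomp_id; rw assoc_nat; rw assoc'K; rewrite !lwhisk_comp.
Qed.

Lemma rwhisk_aux (B : Bicategory) (X' X Y K : B) (l : X' ⟶ X) (h : K ⟶ Y)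
    (d0 d1 : X ⟶ K) (f g : X ⟶ Y) (e : h ⊙ d1 ⇒ g) (c : d0 ⇒ d1) (n : f ⇒ h ⊙ d0) :
  ((e ▷ l) ∘ assoc' h d1 l) ∘ ((h ◁ (c ▷ l)) ∘ (assoc h d0 l ∘ (n ▷ l)))
  = (e ∘ ((h ◁ c) ∘ n)) ▷ l.
Proof.
by rwb assoc_nat; rw assocK; rewrite !rwhisk_comp.
Qed.

Lemma cyl_aux (B : Bicategory) (X' X K Z : B) (l : X' ⟶ X) (s : K ⟶ Z)
    (d0 d1 : X ⟶ K) (x : X ⟶ Z) (a0 : s ⊙ d0 ⇒ x) (a1' : x ⇒ s ⊙ d1) (c : d0 ⇒ d1) :
  s ◁ c = a1' ∘ a0 ->
  s ◁ (c ▷ l) = (assoc s d1 l ∘ (a1' ▷ l)) ∘ ((a0 ▷ l) ∘ assoc' s d0 l).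
Proof.
move=> e.
by rwb rwhisk_comp; rewrite -e; rw assoc_nat; rw assoc'K.
Qed.

Section Homotopies.
Variables (C : Bicategory) (W : arrow_family C).

Record Cylinder (X : C) := {
  cyl_W : C;
  cyl_Z : C;
  cyl_d0 : X ⟶ cyl_W;
  cyl_d1 : X ⟶ cyl_W;
  cyl_x : X ⟶ cyl_Z;
  cyl_s : cyl_W ⟶ cyl_Z;
  cyl_sW : W cyl_s;
  cyl_α0 : iso2 (cyl_s ⊙ cyl_d0) cyl_x;
  cyl_α1 : iso2 (cyl_s ⊙ cyl_d1) cyl_x
}.

Definition cyl_α (X : C) (K : Cylinder X) : cyl_s K ⊙ cyl_d0 K ⇒ cyl_s K ⊙ cyl_d1 K :=
  bwd (cyl_α1 K) ∘ cyl_α0 K.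

Record Homotopy (X Y : C) (f g : X ⟶ Y) := {
  ht_cyl : Cylinder X;
  ht_h : cyl_W ht_cyl ⟶ Y;
  ht_η : f ⇒ ht_h ⊙ cyl_d0 ht_cyl;
  ht_ε : ht_h ⊙ cyl_d1 ht_cyl ⇒ g
}.

Definition ht_lwhisk (X Y Y' : C) (r : Y ⟶ Y') (f g : X ⟶ Y) (H : Homotopy f g) :
    Homotopy (r ⊙ f) (r ⊙ g) :=
  {| ht_cyl := ht_cyl H;
     ht_h := r ⊙ ht_h H;
     ht_η := assoc' r (ht_h H) (cyl_d0 (ht_cyl H)) ∘ (r ◁ ht_η H);
     ht_ε := (r ◁ ht_ε H) ∘ assoc r (ht_h H) (cyl_d1 (ht_cyl H)) |}.

Definition cyl_rwhisk (X' X : C) (K : Cylinder X) (l : X' ⟶ X) : Cylinder X' :=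
  {| cyl_W := cyl_W K;
     cyl_Z := cyl_Z K;
     cyl_d0 := cyl_d0 K ⊙ l;
     cyl_d1 := cyl_d1 K ⊙ l;
     cyl_x := cyl_x K ⊙ l;
     cyl_s := cyl_s K;
     cyl_sW := cyl_sW K;
     cyl_α0 := iso_comp (iso_hcomp (cyl_α0 K) (iso_id l))
                        (iso_inv (iso_assoc (cyl_s K) (cyl_d0 K) l));
     cyl_α1 := iso_comp (iso_hcomp (cyl_α1 K) (iso_id l))
                        (iso_inv (iso_assoc (cyl_s K) (cyl_d1 K) l)) |}.

Definition ht_rwhisk (X' X Y : C) (f g : X ⟶ Y) (H : Homotopy f g) (l : X' ⟶ X) :
    Homotopy (f ⊙ l) (g ⊙ l) :=
  {| ht_cyl := cyl_rwhisk (ht_cyl H) l;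
     ht_h := ht_h H;
     ht_η := assoc (ht_h H) (cyl_d0 (ht_cyl H)) l ∘ (ht_η H ▷ l) ;
     ht_ε := (ht_ε H ▷ l) ∘ assoc' (ht_h H) (cyl_d1 (ht_cyl H)) l |}.

(* Nonempty sequences of composable homotopies from [f]; [hs_cons s H] is
   [H, H^n, ..., H^1] for [s] equal to [H^n, ..., H^1]. *)
Inductive HSeq (X Y : C) (f : X ⟶ Y) : X ⟶ Y -> Type :=
  | hs_one : forall g, Homotopy f g -> HSeq f g
  | hs_cons : forall g h, HSeq f g -> Homotopy g h -> HSeq f h.

Fixpoint hs_cat (X Y : C) (f g h : X ⟶ Y) (s : HSeq f g) (t : HSeq g h) : HSeq f h :=
  match t in HSeq _ h return HSeq f h with
  | hs_one H => hs_cons s H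
  | hs_cons t' H => hs_cons (hs_cat s t') H
  end.

Fixpoint hs_lwhisk (X Y Y' : C) (r : Y ⟶ Y') (f g : X ⟶ Y) (s : HSeq f g) :
    HSeq (r ⊙ f) (r ⊙ g) :=
  match s in HSeq _ g return HSeq (r ⊙ f) (r ⊙ g) with
  | hs_one H => hs_one (ht_lwhisk r H)
  | hs_cons s' H => hs_cons (hs_lwhisk r s') (ht_lwhisk r H)
  end.

Fixpoint hs_rwhisk (X' X Y : C) (f g : X ⟶ Y) (s : HSeq f g) (l : X' ⟶ X) :
    HSeq (f ⊙ l) (g ⊙ l) :=
  match s in HSeq _ g return HSeq (f ⊙ l) (g ⊙ l) with
  | hs_one H => hs_one (ht_rwhisk H l)
  | hs_cons s' H => hs_cons (hs_rwhisk s' l) (ht_rwhisk H l)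
  end.

Section Hat.
Variables (D : Bicategory) (F : Pseudofunctor C D).
Hypothesis hF : maps_to W (@quasiequivalence D) F.

Lemma hat_cyl_subproof (X : C) (K : Cylinder X) :
  exists! γ : F1 F (cyl_d0 K) ⇒ F1 F (cyl_d1 K),
    F1 F (cyl_s K) ◁ γ
    = bwd (phi F (cyl_s K) (cyl_d1 K)) ∘
      (F2 F (cyl_α K) ∘ phi F (cyl_s K) (cyl_d0 K)).
Proof. exact: (proj1 (hF (cyl_sW K))). Qed.

Definition hat_cyl (X : C) (K : Cylinder X) : F1 F (cyl_d0 K) ⇒ F1 F (cyl_d1 K) :=
  proj1_sig (constructive_indefinite_description _ (hat_cyl_subproof K)).

(* For a 2-functor [F] the structural 2-cells below are identities. *)
Definition hat_ht (X Y : C) (f g : X ⟶ Y) (H : Homotopy f g) : F1 F f ⇒ F1 F g :=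
  F2 F (ht_ε H) ∘
  ((phi F (ht_h H) (cyl_d1 (ht_cyl H)) ∘
    ((F1 F (ht_h H) ◁ hat_cyl (ht_cyl H)) ∘
     bwd (phi F (ht_h H) (cyl_d0 (ht_cyl H))))) ∘
   F2 F (ht_η H)).

Fixpoint hat_seq (X Y : C) (f g : X ⟶ Y) (s : HSeq f g) : F1 F f ⇒ F1 F g :=
  match s in HSeq _ g return F1 F f ⇒ F1 F g with
  | hs_one H => hat_ht H
  | hs_cons s' H => hat_ht H ∘ hat_seq s'
  end.

Lemma hat_cylP (X : C) (K : Cylinder X) :
  F1 F (cyl_s K) ◁ hat_cyl K
    = bwd (phi F (cyl_s K) (cyl_d1 K)) ∘
      (F2 F (cyl_α K) ∘ phi F (cyl_s K) (cyl_d0 K)).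
Proof.
by rewrite /hat_cyl; case: constructive_indefinite_description => γ [].
Qed.

Lemma hat_cyl_uniq (X : C) (K : Cylinder X) (γ : F1 F (cyl_d0 K) ⇒ F1 F (cyl_d1 K)) :
  phi F (cyl_s K) (cyl_d1 K) ∘
    ((F1 F (cyl_s K) ◁ γ) ∘ bwd (phi F (cyl_s K) (cyl_d0 K))) = F2 F (cyl_α K) ->
  hat_cyl K = γ.
Proof.
move=> e; case: (hat_cyl_subproof K) => γ0 [_ u].
rewrite -(u _ (hat_cylP K)); apply: u.
by rewrite -e; rw fwdK; rw fwdK.
Qed.

Lemma hat_cylPB (X : C) (K : Cylinder X) :
  @hcomp (pullback F) _ _ _ _ _ _ _ (id2 (F1 F (cyl_s K))) (hat_cyl K)
  = F2 F (cyl_α K).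
Proof. by rewrite /= hat_cylP; rw bwdK; rw bwdK. Qed.

Lemma hat_htE (X Y : C) (f g : X ⟶ Y) (H : Homotopy f g) :
  hat_ht H = @vcomp (pullback F) _ _ _ _ _ (F2 F (ht_ε H))
    (@vcomp (pullback F) _ _ _ _ _
      (@hcomp (pullback F) _ _ _ (ht_h H) (ht_h H) _ _ (@id2 (pullback F) _ _ (ht_h H))
         (hat_cyl (ht_cyl H))) (F2 F (ht_η H))).
Proof. by []. Qed.

Lemma hat_ht_lwhisk (X Y Y' : C) (r : Y ⟶ Y') (f g : X ⟶ Y) (H : Homotopy f g) :
  hat_ht (ht_lwhisk r H) = phi F r g ∘ ((F1 F r ◁ hat_ht H) ∘ bwd (phi F r f)).
Proof.
rewrite !hat_htE /ht_lwhisk; cbn [ht_cyl ht_h ht_η ht_ε].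
rewrite !F2_comp !F2_hcompB F2_id.
exact: (@lwhisk_aux (pullback F)).
Qed.

Lemma hat_cyl_rwhisk (X' X : C) (K : Cylinder X) (l : X' ⟶ X) :
  hat_cyl (cyl_rwhisk K l)
  = phi F (cyl_d1 K) l ∘ ((hat_cyl K ▷ F1 F l) ∘ bwd (phi F (cyl_d0 K) l)).
Proof.
apply: hat_cyl_uniq; rewrite /cyl_α /= !F2_comp !F2_hcompB !F2_id.
apply: (@cyl_aux (pullback F)).
by rewrite [LHS]hat_cylPB /cyl_α F2_comp.
Qed.

Lemma hat_ht_rwhisk (X' X Y : C) (f g : X ⟶ Y) (H : Homotopy f g) (l : X' ⟶ X) :
  hat_ht (ht_rwhisk H l) = phi F g l ∘ ((hat_ht H ▷ F1 F l) ∘ bwd (phi F f l)).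
Proof.
rewrite !hat_htE /ht_rwhisk; cbn [ht_cyl ht_h ht_η ht_ε].
rewrite !F2_comp !F2_hcompB F2_id hat_cyl_rwhisk.
exact: (@rwhisk_aux (pullback F)).
Qed.

Lemma hat_lwhisk (X Y Y' : C) (r : Y ⟶ Y') (f g : X ⟶ Y) (s : HSeq f g) :
  hat_seq (hs_lwhisk r s)
  = phi F r g ∘ ((F1 F r ◁ hat_seq s) ∘ bwd (phi F r f)).
Proof.
elim: s => [g' H|g' g'' s IH H] /=; first exact: hat_ht_lwhisk.
rewrite IH hat_ht_lwhisk; symmetry.
exact: (@lwhisk_comp (pullback F) _ _ _ r _ _ _ (hat_ht H) (hat_seq s)).
Qed.

Lemma hat_rwhisk (X' X Y : C) (f g : X ⟶ Y) (s : HSeq f g) (l : X' ⟶ X) :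
  hat_seq (hs_rwhisk s l)
  = phi F g l ∘ ((hat_seq s ▷ F1 F l) ∘ bwd (phi F f l)).
Proof.
elim: s => [g' H|g' g'' s IH H] /=; first exact: hat_ht_rwhisk.
rewrite IH hat_ht_rwhisk; symmetry.
exact: (@rwhisk_comp (pullback F) _ _ _ l _ _ _ (hat_ht H) (hat_seq s)).
Qed.

Lemma hat_cat (X Y : C) (f g h : X ⟶ Y) (s : HSeq f g) (t : HSeq g h) :
  hat_seq (hs_cat s t) = hat_seq t ∘ hat_seq s.
Proof. by elim: t => [//|g' g'' t IH H] /=; rewrite IH vassoc. Qed.

End Hat.

Definition contains_identities : Prop := forall X : C, W (idA X).

Section HoDef.
Hypothesis W_id : contains_identities.

Definition cyl_I (X : C) : Cylinder X :=
  {| cyl_W := X;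
     cyl_Z := X;
     cyl_d0 := idA X;
     cyl_d1 := idA X;
     cyl_x := idA X;
     cyl_s := idA X;
     cyl_sW := W_id X;
     cyl_α0 := iso_lun (idA X);
     cyl_α1 := iso_lun (idA X) |}.

(* A homotopy [I^μ]: [hat_I] shows that its value under every [F] is [F μ]. *)
Definition ht_I (X Y : C) (f g : X ⟶ Y) (μ : f ⇒ g) : Homotopy f g :=
  {| ht_cyl := cyl_I X;
     ht_h := g : cyl_W (cyl_I X) ⟶ Y;
     ht_η := run' g ∘ μ;
     ht_ε := run g |}.

Lemma hat_I (D : Bicategory) (F : Pseudofunctor C D)
    (hF : maps_to W (@quasiequivalence D) F) (X Y : C) (f g : X ⟶ Y) (μ : f ⇒ g) :
  hat_ht hF (ht_I μ) = F2 F μ.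
Proof.
have e : hat_cyl hF (cyl_I X) = id2 (F1 F (idA X)).
  apply: hat_cyl_uniq; rewrite /cyl_α /= lunK F2_id.
  by rewrite hcomp_id vidl bwdK.
rewrite /hat_ht /= e hcomp_id vidl bwdK vidl -F2_comp.
by rw run'K.
Qed.

(* Only 2-functors [F] occur here, as opposed to arbitrary pseudofunctors. *)
Definition hs_eq (X Y : C) (f g : X ⟶ Y) (s t : HSeq f g) : Prop :=
  forall (D : Bicategory) (F : Pseudofunctor C D), is_2functor F ->
  forall hF : maps_to W (@quasiequivalence D) F, hat_seq hF s = hat_seq hF t.

(* Equivalence classes, as predicates on representatives. *)
Definition HoCell (X Y : C) (f g : X ⟶ Y) : Type :=
  {P : HSeq f g -> Prop | exists s, P = hs_eq s}.

Definition ho_class (X Y : C) (f g : X ⟶ Y) (s : HSeq f g) : HoCell f g :=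
  exist _ (hs_eq s) (ex_intro _ s eq_refl).

Definition ho_repr (X Y : C) (f g : X ⟶ Y) (a : HoCell f g) : HSeq f g :=
  proj1_sig (constructive_indefinite_description _ (proj2_sig a)).

Lemma ho_classP (X Y : C) (f g : X ⟶ Y) (s t : HSeq f g) :
  ho_class s = ho_class t <-> hs_eq s t.
Proof.
split=> [[e]|e].
  by change (hs_eq s t); rewrite e => D F sF hF.
apply: eq_sig_hprop => [P p q|/=]; first exact: proof_irrelevance.
apply: functional_extensionality_dep => u; apply: propositional_extensionality.
by split=> e' D F sF hF; rewrite -(e' D F sF hF) (e D F sF hF).
Qed.

Lemma ho_reprK (X Y : C) (f g : X ⟶ Y) (a : HoCell f g) : ho_class (ho_repr a) = a.
Proof.
rewrite /ho_repr; case: constructive_indefinite_description => s /= e.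
by apply: eq_sig_hprop => [P p q|/=]; first exact: proof_irrelevance.
Qed.

Lemma hat_repr (D : Bicategory) (F : Pseudofunctor C D) (sF : is_2functor F)
    (hF : maps_to W (@quasiequivalence D) F) (X Y : C) (f g : X ⟶ Y) (s : HSeq f g) :
  hat_seq hF (ho_repr (ho_class s)) = hat_seq hF s.
Proof. by apply: (proj1 (ho_classP _ _)) => //; apply: ho_reprK. Qed.

Lemma ho_ext (X Y : C) (f g : X ⟶ Y) (a b : HoCell f g) :
  (forall (D : Bicategory) (F : Pseudofunctor C D), is_2functor F ->
   forall hF : maps_to W (@quasiequivalence D) F,
   hat_seq hF (ho_repr a) = hat_seq hF (ho_repr b)) -> a = b.
Proof. by move=> e; rewrite -(ho_reprK a) -(ho_reprK b); apply/ho_classP. Qed.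

Definition ho_incl (X Y : C) (f g : X ⟶ Y) (μ : f ⇒ g) : HoCell f g :=
  ho_class (hs_one (ht_I μ)).

Definition ho_vcomp (X Y : C) (f g h : X ⟶ Y) (b : HoCell g h) (a : HoCell f g) :
    HoCell f h :=
  ho_class (hs_cat (ho_repr a) (ho_repr b)).

Definition ho_lwhisk (X Y Z : C) (r : Y ⟶ Z) (f g : X ⟶ Y) (a : HoCell f g) :
    HoCell (r ⊙ f) (r ⊙ g) :=
  ho_class (hs_lwhisk r (ho_repr a)).

Definition ho_rwhisk (X Y Z : C) (f g : Y ⟶ Z) (a : HoCell f g) (l : X ⟶ Y) :
    HoCell (f ⊙ l) (g ⊙ l) :=
  ho_class (hs_rwhisk (ho_repr a) l).

Definition ho_hcomp (X Y Z : C) (g g' : Y ⟶ Z) (f f' : X ⟶ Y)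
    (b : HoCell g g') (a : HoCell f f') : HoCell (g ⊙ f) (g' ⊙ f') :=
  ho_vcomp (ho_rwhisk b f') (ho_lwhisk g a).

(* The operations above do not depend on the representatives. *)
Lemma ho_vcomp_class (X Y : C) (f g h : X ⟶ Y) (t : HSeq g h) (s : HSeq f g) :
  ho_vcomp (ho_class t) (ho_class s) = ho_class (hs_cat s t).
Proof.
by apply/ho_classP => D F sF hF; rewrite !hat_cat !hat_repr.
Qed.

Lemma ho_lwhisk_class (X Y Z : C) (r : Y ⟶ Z) (f g : X ⟶ Y) (s : HSeq f g) :
  ho_lwhisk r (ho_class s) = ho_class (hs_lwhisk r s).
Proof.
by apply/ho_classP => D F sF hF; rewrite !hat_lwhisk !hat_repr.
Qed.

Lemma ho_rwhisk_class (X Y Z : C) (f g : Y ⟶ Z) (s : HSeq f g) (l : X ⟶ Y) :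
  ho_rwhisk (ho_class s) l = ho_class (hs_rwhisk s l).
Proof.
by apply/ho_classP => D F sF hF; rewrite !hat_rwhisk !hat_repr.
Qed.

Section Ev.
Variables (D : Bicategory) (F : Pseudofunctor C D) (sF : is_2functor F).
Variable hF : maps_to W (@quasiequivalence D) F.

Definition ev (X Y : C) (f g : X ⟶ Y) (a : HoCell f g) : @cell (pullback F) X Y f g :=
  hat_seq hF (ho_repr a).

Lemma ev_incl (X Y : C) (f g : X ⟶ Y) (μ : f ⇒ g) : ev (ho_incl μ) = F2 F μ.
Proof. by rewrite /ev hat_repr //= hat_I. Qed.

Lemma ev_id (X Y : C) (f : X ⟶ Y) :
  ev (ho_incl (id2 f)) = @id2 (pullback F) X Y f.
Proof. by rewrite ev_incl F2_id. Qed.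

Lemma ev_vcomp (X Y : C) (f g h : X ⟶ Y) (b : HoCell g h) (a : HoCell f g) :
  ev (ho_vcomp b a) = @vcomp (pullback F) _ _ _ _ _ (ev b) (ev a).
Proof. by rewrite /ev hat_repr // hat_cat. Qed.

Lemma ev_hcomp (X Y Z : C) (g g' : Y ⟶ Z) (f f' : X ⟶ Y)
    (b : HoCell g g') (a : HoCell f f') :
  ev (ho_hcomp b a) = @hcomp (pullback F) _ _ _ _ _ _ _ (ev b) (ev a).
Proof.
rewrite ev_vcomp /ev /ho_rwhisk /ho_lwhisk !hat_repr // hat_rwhisk hat_lwhisk.
exact: (@exch_rl (pullback F)).
Qed.
End Ev.

Lemma ho_evI (X Y : C) (f g : X ⟶ Y) (a b : HoCell f g) :
  (forall (D : Bicategory) (F : Pseudofunctor C D), is_2functor F ->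
   forall hF : maps_to W (@quasiequivalence D) F, ev hF a = ev hF b) -> a = b.
Proof. exact: ho_ext. Qed.

#[local] Ltac ho_law :=
  move=> *; apply: ho_evI => D F sF hF;
  match goal with sF : is_2functor _ |- _ =>
    rewrite !(ev_hcomp sF, ev_vcomp sF, ev_id sF, ev_incl sF)
  end.

Program Definition Ho : Bicategory :=
  {| ob := C;
     arr := fun X Y => X ⟶ Y;
     cell := HoCell;
     idA := fun X => idA X;
     compA := fun X Y Z g f => g ⊙ f;
     id2 := fun X Y f => ho_incl (id2 f);
     vcomp := ho_vcomp;
     hcomp := ho_hcomp;
     assoc := fun X Y Z T h g f => ho_incl (assoc h g f);
     assoc' := fun X Y Z T h g f => ho_incl (assoc' h g f);
     lun := fun X Y f => ho_incl (lun f);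
     lun' := fun X Y f => ho_incl (lun' f);
     run := fun X Y f => ho_incl (run f);
     run' := fun X Y f => ho_incl (run' f) |}.
Next Obligation. by ho_law; apply: (@vassoc (pullback F)). Qed.
Next Obligation. by ho_law; apply: (@vidl (pullback F)). Qed.
Next Obligation. by ho_law; apply: (@vidr (pullback F)). Qed.
Next Obligation. by ho_law; apply: (@hcomp_id (pullback F)). Qed.
Next Obligation. by ho_law; apply: (@interchange (pullback F)). Qed.
Next Obligation. by ho_law; apply: (@assoc_nat (pullback F)). Qed.
Next Obligation. by ho_law; apply: (@lun_nat (pullback F)). Qed.
Next Obligation. by ho_law; apply: (@run_nat (pullback F)). Qed.
Next Obligation. by ho_law; apply: (@assocK (pullback F)). Qed.
Next Obligation. by ho_law; apply: (@assoc'K (pullback F)). Qed.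
Next Obligation. by ho_law; apply: (@lunK (pullback F)). Qed.
Next Obligation. by ho_law; apply: (@lun'K (pullback F)). Qed.
Next Obligation. by ho_law; apply: (@runK (pullback F)). Qed.
Next Obligation. by ho_law; apply: (@run'K (pullback F)). Qed.
Next Obligation. by ho_law; apply: (@pentagon (pullback F)). Qed.
Next Obligation. by ho_law; apply: (@triangle (pullback F)). Qed.

Program Definition ho_i : Pseudofunctor C Ho :=
  {| F0 := fun X : C => X : Ho;
     F1 := fun X Y f => f : @arr Ho X Y;
     F2 := fun X Y f g μ => ho_incl μ;
     phi := fun X Y Z g f => iso_id (C := Ho) (X := X) (Y := Z) (g ⊙ f);
     xi := fun X => iso_id (C := Ho) (X := X) (Y := X) (idA X) |}.
Next Obligation. by []. Qed.
Next Obligation. by ho_law; rewrite F2_comp. Qed.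
Next Obligation.
by ho_law; rewrite F2_hcompB (@vidl (pullback F)) (@vidr (pullback F)).
Qed.
Next Obligation.
by ho_law; rewrite !(@hcomp_id (pullback F)) !(@vidl (pullback F)) !(@vidr (pullback F)).
Qed.
Next Obligation.
by ho_law; rewrite !(@hcomp_id (pullback F)) !(@vidr (pullback F)).
Qed.
Next Obligation.
by ho_law; rewrite !(@hcomp_id (pullback F)) !(@vidr (pullback F)).
Qed.

Lemma ho_i_2functor : is_2functor ho_i.
Proof. by split=> *; exists eq_refl. Qed.

End HoDef.

Definition three_for_two : Prop :=
  forall (X Y Z : C) (f : X ⟶ Y) (g : Y ⟶ Z) (h : X ⟶ Z),
    isomorphic (g ⊙ f) h ->
    (W f -> W g -> W h) /\ (W f -> W h -> W g) /\ (W g -> W h -> W f).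

Definition is_section (X Y : C) (s : X ⟶ Y) : Prop :=
  exists r : Y ⟶ X, isomorphic (r ⊙ s) (idA X).

Definition is_retraction (X Y : C) (r : Y ⟶ X) : Prop :=
  exists s : X ⟶ Y, isomorphic (r ⊙ s) (idA X).

Definition is_split (X Y : C) (f : X ⟶ Y) : Prop :=
  is_section f \/ is_retraction f.

Inductive split_composite : forall X Y : C, X ⟶ Y -> Prop :=
  | sc_one : forall (X Y : C) (f : X ⟶ Y),
      W f -> is_split f -> split_composite f
  | sc_comp : forall (X Y Z : C) (g : Y ⟶ Z) (f : X ⟶ Y),
      W g -> is_split g -> split_composite f -> split_composite (g ⊙ f).

Definition split_generated : Prop :=
  forall (X Y : C) (w : X ⟶ Y), W w ->
    exists c : X ⟶ Y, split_composite c /\ isomorphic c w.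

End Homotopies.

(* Main.v *)
(** If [r ⊙ s ≅ id] and [r] lies in [W], then [s ⊙ r] and [id] become isomorphic
    after composition with [r], so they are the two ends of a cylinder, whose
    class in [Ho] is invertible.  By 3 for 2 every split arrow of [W] thus
    becomes an equivalence in [Ho], and by hypothesis so does all of [W].

    The class of a cylinder [K] is a 2-cell [d0 ⇒ d1] of [Ho] which whiskering
    with [s] turns into [i α], and every 2-cell of [Ho] is composed of such
    classes and of 2-cells of the form [i μ].  Hence a pseudofunctor [F] out of
    [Ho] is determined by [F i], its value on a class of homotopies being the
    hat of the sequence under [F i]; and naturality of a transformation with
    respect to the 2-cells of [C] propagates to the hats, hence to all of [Ho]. *)

From Corelib Require Import ssreflect ssrfun.
From Stdlib Require Import FunctionalExtensionality ProofIrrelevance.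
Require Import Defs.

Set Implicit Arguments.
Unset Strict Implicit.
Unset Printing Implicit Defensive.
#[local] Obligation Tactic := idtac.

(** * Invertible 2-cells, equivalences and quasiequivalences *)

Section Equivalences.
Variable C : Bicategory.

Lemma iso2_eq (X Y : C) (f g : X ⟶ Y) (i j : iso2 f g) : fwd i = fwd j -> i = j.
Proof.
case: i j => [a b ba ab] [a' b' ba' ab'] /= e; subst a'.
have e : b = b' by apply: (cancel_r ab); rewrite ba ba'.
by subst b'; rewrite (proof_irrelevance _ ba ba') (proof_irrelevance _ ab ab').
Qed.

Lemma isomorphic_retract_comp (X Y Z : C)
    (f : X ⟶ Y) (g : Y ⟶ X) (f' : Y ⟶ Z) (g' : Z ⟶ Y) :
  isomorphic (g ⊙ f) (idA X) -> isomorphic (g' ⊙ f') (idA Y) ->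
  isomorphic ((g ⊙ g') ⊙ (f' ⊙ f)) (idA X).
Proof.
case=> i [j]; constructor.
apply: (iso_comp i); apply: (iso_comp (iso_hcomp (iso_id g) (iso_lun f))).
apply: (iso_comp (iso_hcomp (iso_id g) (iso_hcomp j (iso_id f)))).
exact: (iso_comp (iso_hcomp (iso_id g) (iso_inv (iso_assoc g' f' f)))
                 (iso_assoc g g' (f' ⊙ f))).
Qed.

Lemma equivalence_comp (X Y Z : C) (g : Y ⟶ Z) (f : X ⟶ Y) :
  equivalence g -> equivalence f -> equivalence (g ⊙ f).
Proof.
move=> [g' [gl gr]] [f' [fl fr]]; exists (f' ⊙ g').
by split; apply: isomorphic_retract_comp.
Qed.

Lemma equivalence_iso (X Y : C) (f g : X ⟶ Y) :
  isomorphic f g -> equivalence f -> equivalence g.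
Proof.
case=> i [f' [[p] [q]]]; exists f'; split; constructor.
- exact: iso_comp p (iso_hcomp (iso_id f') (iso_inv i)).
- exact: iso_comp q (iso_hcomp (iso_inv i) (iso_id f')).
Qed.

Section RetractLeft.
Variables (X Y : C) (f : X ⟶ Y) (g : Y ⟶ X) (p : iso2 (g ⊙ f) (idA X)).

Definition retract_l (Z : C) (a : Z ⟶ X) : iso2 (g ⊙ (f ⊙ a)) a :=
  iso_comp (iso_lun a)
    (iso_comp (iso_hcomp p (iso_id a)) (iso_inv (iso_assoc g f a))).

Lemma retract_l_nat (Z : C) (a b : Z ⟶ X) (α : a ⇒ b) :
  retract_l b ∘ (g ◁ (f ◁ α)) = α ∘ retract_l a.
Proof.
rewrite /=; rw assoc'_nat; rewrite hcomp_id; rwb exch.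
by rw lun_nat.
Qed.

Definition retract_r (Z : C) (a : X ⟶ Z) : iso2 ((a ⊙ g) ⊙ f) a :=
  iso_comp (iso_run a)
    (iso_comp (iso_hcomp (iso_id a) p) (iso_assoc a g f)).

Lemma retract_r_nat (Z : C) (a b : X ⟶ Z) (α : a ⇒ b) :
  retract_r b ∘ ((α ▷ g) ▷ f) = α ∘ retract_r a.
Proof.
rewrite /=; rw assoc_nat; rewrite hcomp_id; rw exch.
by rw run_nat.
Qed.

Lemma retract_l_faithful (Z : C) (a b : Z ⟶ X) (α α' : a ⇒ b) :
  f ◁ α = f ◁ α' -> α = α'.
Proof.
move=> e; apply: (cancel_r (bwdK (i := retract_l a))).
by rewrite -!retract_l_nat e.
Qed.

Lemma retract_r_faithful (Z : C) (a b : X ⟶ Z) (α α' : a ⇒ b) :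
  α ▷ g = α' ▷ g -> α = α'.
Proof.
move=> e; apply: (cancel_r (bwdK (i := retract_r a))).
by rewrite -!retract_r_nat e.
Qed.
End RetractLeft.

(** Naturality of [retract_l p] forces the preimage of [β] to be [g ◁ β] conjugated by it. That [f]
    whiskers this 2-cell back to [β] is checked after whiskering with [g], which is faithful because
    [f ⊙ g ≅ id]. The other side is symmetric. *)
Lemma equivalence_quasi (X Y : C) (f : X ⟶ Y) : equivalence f -> quasiequivalence f.
Proof.
case=> g [[p] [q]]; split=> Z a b β.
- exists (retract_l p b ∘ ((g ◁ β) ∘ bwd (retract_l p a))).
  split=> [|α <-]; last by rewrite -vassoc retract_l_nat vassoc bwdK vidr.
  apply: (retract_l_faithful q); apply: (cancel_l (fwdK (i := retract_l p b))).
  by rewrite retract_l_nat 2!vassoc fwdK vidr.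
- exists (retract_r q b ∘ ((β ▷ g) ∘ bwd (retract_r q a))).
  split=> [|α <-]; last by rewrite -vassoc retract_r_nat vassoc bwdK vidr.
  apply: (retract_r_faithful p); apply: (cancel_l (fwdK (i := retract_r q b))).
  by rewrite retract_r_nat 2!vassoc fwdK vidr.
Qed.

Lemma maps_to_quasi (B : Bicategory) (W : arrow_family B) (F : Pseudofunctor B C) :
  maps_to W (@equivalence C) F -> maps_to W (@quasiequivalence C) F.
Proof. by move=> h X Y f /h; apply: equivalence_quasi. Qed.

End Equivalences.

(** * Equality and strict composition of pseudofunctors *)

(** Both sides share [f0] and [f1], so the remaining data have the same types and are compared
    without transport; the laws are proof irrelevant. *)
Lemma Build_Pseudofunctor_eq (C D : Bicategory)
    f0 f1 f2 f2' ph ph' x x' a1 a2 a3 a4 a5 a6 b1 b2 b3 b4 b5 b6 :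
  (forall X Y f g a, f2 X Y f g a = f2' X Y f g a) ->
  (forall X Y Z g f, fwd (ph X Y Z g f) = fwd (ph' X Y Z g f)) ->
  (forall X, fwd (x X) = fwd (x' X)) ->
  @Build_Pseudofunctor C D f0 f1 f2 ph x a1 a2 a3 a4 a5 a6
  = @Build_Pseudofunctor C D f0 f1 f2' ph' x' b1 b2 b3 b4 b5 b6.
Proof.
move=> e2 ep ex.
have ? : f2 = f2'.
  by do 5! [apply: functional_extensionality_dep => ?]; apply: e2.
have ? : ph = ph'.
  by do 5! [apply: functional_extensionality_dep => ?]; apply/iso2_eq/ep.
have ? : x = x' by apply: functional_extensionality_dep => X; apply/iso2_eq/ex.
by subst f2' ph' x'; f_equal; apply: proof_irrelevance.
Qed.

Lemma Build_Pseudofunctor_eqr (C D : Bicategory) (Q : Pseudofunctor C D)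
    f2 ph x a1 a2 a3 a4 a5 a6 :
  (forall X Y f g a, f2 X Y f g a = F2 Q a) ->
  (forall X Y Z g f, fwd (ph X Y Z g f) = phi Q g f) ->
  (forall X, fwd (x X) = xi Q X) ->
  @Build_Pseudofunctor C D (F0 Q) (@F1 C D Q) f2 ph x a1 a2 a3 a4 a5 a6 = Q.
Proof. by case: Q f2 ph x a1 a2 a3 a4 a5 a6 => *; apply: Build_Pseudofunctor_eq. Qed.

Lemma compPF_assoc (A B C D : Bicategory) (H : Pseudofunctor C D)
    (G : Pseudofunctor B C) (F : Pseudofunctor A B) :
  compPF (compPF H G) F = compPF H (compPF G F).
Proof.
by apply: Build_Pseudofunctor_eq => [//|X Y Z g f|X] /=; rewrite F2_comp vassoc.
Qed.

Lemma compPF_idl (A B : Bicategory) (F : Pseudofunctor A B) : compPF (idPF B) F = F.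
Proof.
case: F => *; apply: Build_Pseudofunctor_eq => [//|X Y Z g f|X] /=; exact: vidr.
Qed.

Lemma compPF_idr (A B : Bicategory) (F : Pseudofunctor A B) : compPF F (idPF A) = F.
Proof.
case: F => f0 f1 f2 ph x id2E *.
by apply: Build_Pseudofunctor_eq => [//|X Y Z g f|X] /=; rewrite id2E vidl.
Qed.

(** * Pseudofunctors bijective on objects, arrows and 2-cells *)

Section BijectivePseudofunctor.
Variables (A B : Bicategory) (F : Pseudofunctor A B).
Variable R1 : forall X Y : A, F X ⟶ F Y -> X ⟶ Y.
Variable R2 : forall (X Y : A) (f g : X ⟶ Y), F1 F f ⇒ F1 F g -> f ⇒ g.
Hypothesis F1K : forall X Y, cancel (@F1 A B F X Y) (@R1 X Y).
Hypothesis R1K : forall X Y, cancel (@R1 X Y) (@F1 A B F X Y).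
Hypothesis F2K : forall X Y f g, cancel (@F2 A B F X Y f g) (@R2 X Y f g).
Hypothesis R2K : forall X Y f g, cancel (@R2 X Y f g) (@F2 A B F X Y f g).

Lemma iso_lift (X Y : A) (f g : X ⟶ Y) (u : iso2 (F1 F f) (F1 F g)) :
  {v : iso2 f g | F2 F (fwd v) = fwd u}.
Proof.
unshelve eexists {| fwd := R2 (fwd u); bwd := R2 (bwd u) |}; last exact: R2K.
- by apply: (can_inj (@F2K _ _ _ _)); rewrite F2_comp !R2K F2_id fwdK.
- by apply: (can_inj (@F2K _ _ _ _)); rewrite F2_comp !R2K F2_id bwdK.
Qed.

(** Each axiom of [G] is the corresponding axiom of [T], once [F2 F], which is injective, has been
    applied and the structural 2-cells of [F] cancelled. *)
Lemma pseudofunctor_lift (X : Bicategory) (T : Pseudofunctor X B) (g0 : X -> A) :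
  (fun x => F (g0 x)) = F0 T ->
  exists G : Pseudofunctor X A, F0 G = g0 /\ compPF F G = T.
Proof.
case: T => t0 t1 t2 ph xi0 t_id t_comp ph_nat ph_assoc ph_lun ph_run /= e.
subst t0.
(* Replacing [t1], and then [t2], by an expression in [F] makes [F G] agree with [T] definitionally
   up to structural 2-cells. *)
have [g1 e] : exists g1 : forall x y : X, x ⟶ y -> g0 x ⟶ g0 y,
    t1 = fun x y f => F1 F (g1 x y f).
  exists (fun x y f => R1 (t1 x y f)).
  by do 3! [apply: functional_extensionality_dep => ?]; rewrite R1K.
subst t1.
have [g2 e] : exists g2 : forall (x y : X) (f g : x ⟶ y), f ⇒ g -> g1 x y f ⇒ g1 x y g,
    t2 = fun x y f g a => F2 F (g2 x y f g a).
  exists (fun x y f g a => R2 (t2 x y f g a)).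
  by do 5! [apply: functional_extensionality_dep => ?]; rewrite R2K.
subst t2.
(* The structural 2-cell of a composite is [F2 F gph ∘ phi F]; solving for it to be [ph] forces this
   choice, and likewise for [gxi]. *)
pose gph x y z (g : y ⟶ z) (f : x ⟶ y) : iso2 (g1 y z g ⊙ g1 x y f) (g1 x z (g ⊙ f)) :=
  proj1_sig (iso_lift (iso_comp (ph x y z g f) (iso_inv (phi F _ _)))).
pose gxi x : iso2 (idA (g0 x)) (g1 x x (idA x)) :=
  proj1_sig (iso_lift (iso_comp (xi0 x) (iso_inv (xi F _)))).
have gphE x y z g f : F2 F (fwd (gph x y z g f)) = ph x y z g f ∘ bwd (phi F _ _).
  exact: (proj2_sig (iso_lift _)).
have gxiE x : F2 F (fwd (gxi x)) = xi0 x ∘ bwd (xi F _).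
  exact: (proj2_sig (iso_lift _)).
have gphE' x y z g f : F2 F (fwd (gph x y z g f)) ∘ phi F _ _ = ph x y z g f.
  by rewrite gphE; rw fwdK.
have gxiE' x : F2 F (fwd (gxi x)) ∘ xi F _ = xi0 x.
  by rewrite gxiE; rw fwdK.
unshelve eexists
  {| F0 := g0; F1 := g1; F2 := g2; phi := gph; xi := gxi |}; last first.
- by split=> //; apply: Build_Pseudofunctor_eq => /=.
- move=> x y f; apply: (can_inj (@F2K _ _ _ _)).
  apply: (cancel_r (bwdK (i := iso_comp (phi F (g1 x y f) (idA (g0 x)))
                                 (iso_hcomp (iso_id _) (xi F (g0 x)))))).
  rewrite /= phi_run !F2_comp; rw phi_nat.
  by rewrite F2_id -lwhisk_comp gxiE'; rw (gphE' _ _ _ _ _); apply: ph_run.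
- move=> x y f; apply: (can_inj (@F2K _ _ _ _)).
  apply: (cancel_r (bwdK (i := iso_comp (phi F (idA (g0 y)) (g1 x y f))
                                 (iso_hcomp (xi F (g0 y)) (iso_id _))))).
  rewrite /= phi_lun !F2_comp; rw phi_nat.
  by rewrite F2_id -rwhisk_comp gxiE'; rw (gphE' _ _ _ _ _); apply: ph_lun.
- move=> x y z w h g f; apply: (can_inj (@F2K _ _ _ _)).
  apply: (cancel_r (bwdK (i := iso_comp (phi F (g1 z w h ⊙ g1 y z g) (g1 x y f))
                                 (iso_hcomp (phi F (g1 z w h) (g1 y z g)) (iso_id _))))).
  rewrite /= !F2_comp; rw phi_nat; rewrite phi_assoc; rw phi_nat.
  rewrite !F2_id; rwb rwhisk_comp; rwb lwhisk_comp; rewrite !gphE'.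
  by rw (gphE' _ _ _ _ _); rw (gphE' _ _ _ _ _); apply: ph_assoc.
- move=> x y z g g' f f' b a; apply: (can_inj (@F2K _ _ _ _)).
  apply: (cancel_r (bwdK (i := phi F (g1 y z g) (g1 x y f)))).
  by rewrite !F2_comp; rw phi_nat; rewrite gphE'; rw (gphE' _ _ _ _ _); apply: ph_nat.
- by move=> x y f g h b a; apply: (can_inj (@F2K _ _ _ _)); rewrite t_comp F2_comp.
- by move=> x y f; apply: (can_inj (@F2K _ _ _ _)); rewrite t_id F2_id.
Qed.

Hypothesis F0_inj : injective (F0 F).

Lemma pseudofunctor_lift_unique (X : Bicategory) (P Q : Pseudofunctor X A) :
  compPF F P = compPF F Q -> P = Q.
Proof.
case: P Q => p0 p1 p2 pph pxi P1 P2 P3 P4 P5 P6 [q0 q1 q2 qph qxi Q1 Q2 Q3 Q4 Q5 Q6] e.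
have ? : p0 = q0.
  apply: functional_extensionality_dep => x; apply: F0_inj.
  exact: (f_equal (fun T => F0 T x) e).
subst q0.
(* Projecting [e] to a dependent pair over data already known to agree, [inj_pair2] yields an
   equality free of transport. *)
have /= e1 := inj_pair2 _ _ _ _ _ (f_equal (fun T => existT
  (fun t0 => forall x y : X, x ⟶ y -> t0 x ⟶ t0 y) (F0 T) (fun x y => @F1 _ _ T x y)) e).
have ? : p1 = q1.
  do 3! [apply: functional_extensionality_dep => ?].
  by apply: (can_inj (@F1K _ _)); exact: (f_equal (fun t => t _ _ _) e1).
subst q1; clear e1.
(* Objects and arrows are packed together, as the base over which the 2-cell data form families. *)
pose M := {t0 : X -> B & forall x y : X, x ⟶ y -> t0 x ⟶ t0 y}.
pose m (T : Pseudofunctor X B) : M := existT _ (F0 T) (fun x y => @F1 _ _ T x y).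
have /= e2 := inj_pair2 _ _ _ _ _ (f_equal (fun T => existT
  (fun t : M => forall (x y : X) (f g : x ⟶ y), f ⇒ g -> projT2 t x y f ⇒ projT2 t x y g)
  (m T) (@F2 _ _ T)) e).
have /= e3 := inj_pair2 _ _ _ _ _ (f_equal (fun T => existT
  (fun t : M => forall (x y z : X) (g : y ⟶ z) (f : x ⟶ y),
     iso2 (projT2 t y z g ⊙ projT2 t x y f) (projT2 t x z (g ⊙ f)))
  (m T) (@phi _ _ T)) e).
have /= e4 := inj_pair2 _ _ _ _ _ (f_equal (fun T => existT
  (fun t : M => forall x : X, iso2 (idA (projT1 t x)) (projT2 t x x (idA x)))
  (m T) (@xi _ _ T)) e).
apply: Build_Pseudofunctor_eq.
- move=> x y f g a; apply: (can_inj (@F2K _ _ _ _)).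
  exact: (f_equal (fun t => t x y f g a) e2).
- move=> x y z g f; apply: (can_inj (@F2K _ _ _ _)).
  apply: (cancel_r (bwdK (i := phi F _ _))).
  exact: (f_equal (fun t => fwd (t x y z g f)) e3).
- move=> x; apply: (can_inj (@F2K _ _ _ _)).
  apply: (cancel_r (bwdK (i := xi F _))).
  exact: (f_equal (fun t => fwd (t x)) e4).
Qed.

(** Lifting the identity of [B] gives [G] with [F G = id]; then [F (G F) = F], and unique lifting
    gives [G F = id]. *)
Lemma bijective_is_isomorphism (R0 : B -> A) :
  (forall Y, F (R0 Y) = Y) -> is_isomorphism F.
Proof.
move=> R0K.
have [|G [_ FG]] := @pseudofunctor_lift B (idPF B) R0.
  by apply: functional_extensionality_dep => Y; apply: R0K.
exists G; split=> //; apply: pseudofunctor_lift_unique.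
by rewrite -compPF_assoc FG compPF_idl compPF_idr.
Qed.

End BijectivePseudofunctor.

(** * Replacing a pseudofunctor by a 2-functor with the same hats *)

Section Strictification.
Variables (C D : Bicategory) (H : Pseudofunctor C D).

(* The hats computed by [H] and by the 2-functor [strictify] coincide, so that
   equality of classes, which is tested on 2-functors only, is respected by all
   pseudofunctors. *)
Program Definition strictify : Pseudofunctor C (pullback H) :=
  {| F0 := fun X : C => X : pullback H;
     F1 := fun X Y f => f : @arr (pullback H) X Y;
     F2 := fun X Y f g a => F2 H a;
     phi := fun X Y Z g f => iso_id (C := pullback H) (X := X) (Y := Z) (g ⊙ f);
     xi := fun X => iso_id (C := pullback H) (X := X) (Y := X) (idA X) |}.
Next Obligation. by move=> *; apply: F2_id. Qed.
Next Obligation. by move=> *; apply: F2_comp. Qed.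
Next Obligation.
by move=> X Y Z g g' f f' b a; rewrite /= F2_hcomp vidl vidr.
Qed.
Next Obligation.
move=> X Y Z T h g f.
by rewrite !(@hcomp_id (pullback H)) !(@vidl (pullback H)) !(@vidr (pullback H)).
Qed.
Next Obligation.
by move=> X Y f; rewrite !(@hcomp_id (pullback H)) !(@vidr (pullback H)).
Qed.
Next Obligation.
by move=> X Y f; rewrite !(@hcomp_id (pullback H)) !(@vidr (pullback H)).
Qed.

Lemma strictify_2functor : is_2functor strictify.
Proof. by split=> *; exists eq_refl. Qed.

Variable W : arrow_family C.
Hypothesis hH : maps_to W (@quasiequivalence D) H.

(** Whiskering in [pullback H] is whiskering in [D] conjugated by the invertible [phi H], so
    bijectivity carries over. *)
Lemma strictify_quasi : maps_to W (@quasiequivalence (pullback H)) strictify.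
Proof.
move=> X Y s /hH [full_l full_r]; split=> Z a b β.
- have [α [αE α_uniq]] := full_l _ _ _ (bwd (phi H s b) ∘ ((β : F1 H (s ⊙ a) ⇒ F1 H (s ⊙ b)) ∘ phi H s a)).
  exists α; split=> [|α' e]; first by rewrite /= αE; rw bwdK; rw bwdK.
  by apply: α_uniq; rewrite -e /=; rw fwdK; rw fwdK.
- have [α [αE α_uniq]] := full_r _ _ _ (bwd (phi H b s) ∘ ((β : F1 H (a ⊙ s) ⇒ F1 H (b ⊙ s)) ∘ phi H a s)).
  exists α; split=> [|α' e]; first by rewrite /= αE; rw bwdK; rw bwdK.
  by apply: α_uniq; rewrite -e /=; rw fwdK; rw fwdK.
Qed.

Lemma hat_cyl_strictify (X : C) (K : Cylinder W X) :
  hat_cyl strictify_quasi K = hat_cyl hH K.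
Proof.
apply: hat_cyl_uniq.
rewrite [LHS](@vidl (pullback H)) [LHS](@vidr (pullback H)).
exact: hat_cylPB.
Qed.

Lemma hat_strictify (X Y : C) (f g : X ⟶ Y) (s : HSeq W f g) :
  hat_seq strictify_quasi s = hat_seq hH s.
Proof.
have ht (k l : X ⟶ Y) (K : Homotopy W k l) : hat_ht strictify_quasi K = hat_ht hH K.
  rewrite [RHS]hat_htE -hat_cyl_strictify /hat_ht.
  by rewrite ![in LHS](@vidl (pullback H)) ![in LHS](@vidr (pullback H)).
elim: s => [k K|k l s IH K]; first exact: ht.
exact: (f_equal2 vcomp (ht _ _ K) IH).
Qed.

Lemma hat_seq_eq (X Y : C) (f g : X ⟶ Y) (s t : HSeq W f g) :
  hs_eq s t -> hat_seq hH s = hat_seq hH t.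
Proof.
by move=> /(_ _ _ strictify_2functor strictify_quasi); rewrite !hat_strictify.
Qed.

Lemma hat_ho_repr (X Y : C) (f g : X ⟶ Y) (s : HSeq W f g) :
  hat_seq hH (ho_repr (ho_class s)) = hat_seq hH s.
Proof. by apply: hat_seq_eq; apply/ho_classP; apply: ho_reprK. Qed.

End Strictification.

(** * Classes of cylinders, and equivalences in [Ho] *)

Section CylinderCell.
Variables (C : Bicategory) (W : arrow_family C) (W_id : contains_identities W).

Definition ht_of_cyl (X : C) (K : Cylinder W X) : Homotopy W (cyl_d0 K) (cyl_d1 K) :=
  {| ht_cyl := K; ht_h := idA (cyl_W K); ht_η := lun' (cyl_d0 K); ht_ε := lun (cyl_d1 K) |}.

Lemma hat_ht_of_cyl (D : Bicategory) (F : Pseudofunctor C D)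
    (hF : maps_to W (@quasiequivalence D) F) (X : C) (K : Cylinder W X) :
  hat_ht hF (ht_of_cyl K) = hat_cyl hF K.
Proof.
rewrite hat_htE /=; rewrite -[LHS](@vassoc (pullback F)) (@lun_nat (pullback F)).
by rewrite (@vassoc (pullback F)) (@lun'K (pullback F)) (@vidr (pullback F)).
Qed.

Definition cyl_cell (X : C) (K : Cylinder W X) : HoCell W (cyl_d0 K) (cyl_d1 K) :=
  ho_class (hs_one (ht_of_cyl K)).

Lemma ev_cyl_cell (D : Bicategory) (F : Pseudofunctor C D) (sF : is_2functor F)
    (hF : maps_to W (@quasiequivalence D) F) (X : C) (K : Cylinder W X) :
  ev hF (cyl_cell K) = hat_cyl hF K.
Proof. by rewrite /ev hat_repr //= hat_ht_of_cyl. Qed.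

(** Under every 2-functor this is the equation that defines [hat_cyl]. *)
Lemma lwhisk_cyl_cell (X : C) (K : Cylinder W X) :
  ho_hcomp (ho_incl W_id (id2 (cyl_s K))) (cyl_cell K) = ho_incl W_id (cyl_α K).
Proof.
apply: ho_evI => D F sF hF.
rewrite (ev_hcomp sF) (ev_id _ sF) (ev_incl _ sF) (ev_cyl_cell sF).
exact: hat_cylPB.
Qed.

(** The formula for [hat_ht], lifted to [Ho]: the 2-cells of [Ho] are generated by cylinder classes
    and images of 2-cells of [C]. *)
Lemma ho_class_ht (X Y : C) (f g : X ⟶ Y) (H : Homotopy W f g) :
  ho_class (hs_one H) =
  ho_vcomp (ho_incl W_id (ht_ε H))
    (ho_vcomp (ho_hcomp (ho_incl W_id (id2 (ht_h H))) (cyl_cell (ht_cyl H)))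
              (ho_incl W_id (ht_η H))).
Proof.
apply: ho_evI => D F sF hF.
rewrite 2!(ev_vcomp sF) (ev_hcomp sF) (ev_id _ sF) !(ev_incl _ sF) (ev_cyl_cell sF).
by rewrite /ev hat_repr //=; apply: hat_htE.
Qed.

Definition cyl_flip (X : C) (K : Cylinder W X) : Cylinder W X :=
  {| cyl_sW := cyl_sW K; cyl_x := cyl_x K;
     cyl_α0 := cyl_α1 K; cyl_α1 := cyl_α0 K |}.

(** Flipping inverts [cyl_α], so whiskering the composite with [F s] gives an identity, and this
    whiskering is faithful. *)
Lemma hat_cyl_flip (D : Bicategory) (F : Pseudofunctor C D)
    (hF : maps_to W (@quasiequivalence D) F) (X : C) (K : Cylinder W X) :
  hat_cyl hF (cyl_flip K) ∘ hat_cyl hF K = id2 _.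
Proof.
have [faithful _] := hF _ _ _ (cyl_sW K).
have [γ [_ u]] := faithful _ _ _ (id2 (F1 F (cyl_s K) ⊙ F1 F (cyl_d0 K))).
rewrite -(u _ hcomp_id); symmetry; apply: u.
rewrite lwhisk_comp (hat_cylP hF (cyl_flip K)) hat_cylP /=.
rw bwdK; rwb F2_comp; rewrite /cyl_α /=; rw bwdK; rw fwdK.
by rewrite F2_id vidl fwdK.
Qed.

Lemma cyl_cell_flip (X : C) (K : Cylinder W X) :
  ho_vcomp (cyl_cell (cyl_flip K)) (cyl_cell K) = ho_incl W_id (id2 (cyl_d0 K)).
Proof.
apply: ho_evI => D F sF hF.
rewrite (ev_vcomp sF) (ev_id _ sF); rewrite -[RHS](hat_cyl_flip hF K).
exact: (f_equal2 vcomp (ev_cyl_cell sF hF (cyl_flip K)) (ev_cyl_cell sF hF K)).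
Qed.

Definition iso_of_cyl (X : C) (K : Cylinder W X) :
    iso2 (C := Ho W_id) (X := X) (Y := cyl_W K) (cyl_d0 K) (cyl_d1 K).
Proof.
refine (Build_iso2 (C := Ho W_id) (X := X) (Y := cyl_W K)
  (fwd := cyl_cell K) (bwd := cyl_cell (cyl_flip K)) _ _).
- exact: cyl_cell_flip.
(* Once [K] is destructed, flipping it twice gives it back by computation. *)
- by have := cyl_cell_flip (cyl_flip K); case: K.
Defined.

(** The inferred ends are [s ⊙ r] and [idA Y], both sent to [r] by composition with [r]. *)
Definition cyl_retraction (X Y : C) (r : Y ⟶ X) (s : X ⟶ Y)
    (p : iso2 (r ⊙ s) (idA X)) (rW : W r) : Cylinder W Y :=
  {| cyl_sW := rW; cyl_α0 := retract_l p r; cyl_α1 := iso_run r |}.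

Lemma ho_retraction (X Y : C) (r : Y ⟶ X) (s : X ⟶ Y) :
  isomorphic (r ⊙ s) (idA X) -> W r ->
  isomorphic (C := Ho W_id) (X := Y) (Y := Y) (s ⊙ r) (idA Y)
  /\ isomorphic (C := Ho W_id) (X := X) (Y := X) (r ⊙ s) (idA X).
Proof.
move=> [p] rW; split; constructor; first exact: (iso_of_cyl (cyl_retraction p rW)).
exact: (iso_map (ho_i W_id) p).
Qed.

Hypothesis W_3for2 : three_for_two W.

Lemma ho_split (X Y : C) (f : X ⟶ Y) :
  W f -> is_split f -> equivalence (C := Ho W_id) (X := X) (Y := Y) f.
Proof.
move=> fW [[r p]|[s p]].
  (* In [r ⊙ f ≅ id] both [f] and the identity lie in [W]. *)
  have rW : W r by have [_ [+ _]] := W_3for2 p; apply.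
  by have [q q'] := ho_retraction p rW; exists r.
by have [q q'] := ho_retraction p fW; exists s.
Qed.

Hypothesis W_split : split_generated W.

Lemma ho_i_equivalence : maps_to W (@equivalence (Ho W_id)) (ho_i W_id).
Proof.
move=> X Y w /W_split [c [cs [p]]].
apply: (equivalence_iso (C := Ho W_id) (f := c)).
  by constructor; exact: (iso_map (ho_i W_id) p).
elim: X Y c / cs {w p} => [X Y f fW fs|X Y Z g f gW gs _ IH]; first exact: ho_split.
exact: (equivalence_comp (C := Ho W_id) (ho_split gW gs) IH).
Qed.
End CylinderCell.

(** * Naturality of pseudonatural transformations with respect to hats *)

Section HatNaturality.
Variables (C D : Bicategory) (P Q : Pseudofunctor C D) (σ : Pseudonat P Q).

(** Left whiskering in [pullback F], spelled out in [D]. *)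
Definition pf_lwhisk (F : Pseudofunctor C D) (X Y Z : C) (h : Y ⟶ Z) (d d' : X ⟶ Y)
    (γ : F1 F d ⇒ F1 F d') : F1 F (h ⊙ d) ⇒ F1 F (h ⊙ d') :=
  phi F h d' ∘ ((F1 F h ◁ γ) ∘ bwd (phi F h d)).

(** Together with [phi_slide], an invertible factor of the axiom [pn_comp]. Both are natural even
    for 2-cells of [D] that do not come from [C], such as hats. *)
Definition pn_slide (X Y Z : C) (h : Y ⟶ Z) (d : X ⟶ Y) :
    iso2 (F1 Q h ⊙ (σ Y ⊙ F1 P d)) (σ Z ⊙ F1 P (h ⊙ d)) :=
  iso_comp (iso_hcomp (iso_id (σ Z)) (phi P h d))
    (iso_comp (iso_assoc (σ Z) (F1 P h) (F1 P d))
    (iso_comp (iso_hcomp (pn1 σ h) (iso_id (F1 P d)))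
              (iso_inv (iso_assoc (F1 Q h) (σ Y) (F1 P d))))).

Definition phi_slide (X Y Z : C) (h : Y ⟶ Z) (d : X ⟶ Y) :
    iso2 (F1 Q h ⊙ (F1 Q d ⊙ σ X)) (F1 Q (h ⊙ d) ⊙ σ X) :=
  iso_comp (iso_hcomp (phi Q h d) (iso_id (σ X)))
           (iso_inv (iso_assoc (F1 Q h) (F1 Q d) (σ X))).

Lemma pn_slide_pn1 (X Y Z : C) (h : Y ⟶ Z) (d : X ⟶ Y) :
  pn_slide h d ∘ (F1 Q h ◁ pn1 σ d) = pn1 σ (h ⊙ d) ∘ phi_slide h d.
Proof. by rewrite /=; rw pn_comp; rw assoc'K. Qed.

Lemma pn_slide_nat (X Y Z : C) (h : Y ⟶ Z) (d d' : X ⟶ Y) (γ : F1 P d ⇒ F1 P d') :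
  pn_slide h d' ∘ (F1 Q h ◁ (σ Y ◁ γ)) = (σ Z ◁ pf_lwhisk h γ) ∘ pn_slide h d.
Proof.
rewrite /= /pf_lwhisk !lwhisk_comp; rw assoc'_nat; rewrite hcomp_id.
rwb exch; rewrite -[in LHS]hcomp_id; rw assoc_nat.
rewrite -[X in _ = _ ∘ (_ ∘ X)]vassoc -lwhisk_comp fwdK.
by rewrite hcomp_id vidl.
Qed.

Lemma phi_slide_nat (X Y Z : C) (h : Y ⟶ Z) (d d' : X ⟶ Y) (γ : F1 Q d ⇒ F1 Q d') :
  phi_slide h d' ∘ (F1 Q h ◁ (γ ▷ σ X)) = (pf_lwhisk h γ ▷ σ X) ∘ phi_slide h d.
Proof.
rewrite /= /pf_lwhisk !rwhisk_comp; rw assoc'_nat.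
rewrite -[X in _ = _ ∘ (_ ∘ X)]vassoc -rwhisk_comp fwdK.
by rewrite hcomp_id vidl.
Qed.

Definition pn_natural (X Y : C) (f g : X ⟶ Y) (a : F1 P f ⇒ F1 P g)
    (b : F1 Q f ⇒ F1 Q g) : Prop :=
  (σ Y ◁ a) ∘ pn1 σ f = pn1 σ g ∘ (b ▷ σ X).

Lemma pn_natural_vcomp (X Y : C) (f g h : X ⟶ Y) (a : F1 P f ⇒ F1 P g)
    (b : F1 Q f ⇒ F1 Q g) (a' : F1 P g ⇒ F1 P h) (b' : F1 Q g ⇒ F1 Q h) :
  pn_natural a' b' -> pn_natural a b -> pn_natural (a' ∘ a) (b' ∘ b).
Proof.
rewrite /pn_natural => e' e.
by rewrite lwhisk_comp rwhisk_comp vassoc e -vassoc e' vassoc.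
Qed.

(** The invertible slides carry one equation to the other. One direction descends along the arrow
    [s] of a cylinder, the other climbs along the arrow [h] of a homotopy. *)
Lemma pn_natural_lwhisk (X Y Z : C) (h : Y ⟶ Z) (d d' : X ⟶ Y)
    (a : F1 P d ⇒ F1 P d') (b : F1 Q d ⇒ F1 Q d') :
  pn_natural (pf_lwhisk h a) (pf_lwhisk h b) <->
  F1 Q h ◁ ((σ Y ◁ a) ∘ pn1 σ d) = F1 Q h ◁ (pn1 σ d' ∘ (b ▷ σ X)).
Proof.
have l : pn_slide h d' ∘ (F1 Q h ◁ ((σ Y ◁ a) ∘ pn1 σ d))
         = ((σ Z ◁ pf_lwhisk h a) ∘ pn1 σ (h ⊙ d)) ∘ phi_slide h d.
  by rewrite lwhisk_comp -vassoc pn_slide_nat vassoc pn_slide_pn1 vassoc.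
have r : pn_slide h d' ∘ (F1 Q h ◁ (pn1 σ d' ∘ (b ▷ σ X)))
         = (pn1 σ (h ⊙ d') ∘ (pf_lwhisk h b ▷ σ X)) ∘ phi_slide h d.
  by rewrite lwhisk_comp -vassoc pn_slide_pn1 vassoc phi_slide_nat vassoc.
split=> e.
- by apply: (cancel_l (fwdK (i := pn_slide h d'))); rewrite l r e.
- by apply: (cancel_r (bwdK (i := phi_slide h d))); rewrite -l -r e.
Qed.

Variable W : arrow_family C.
Hypothesis hP : maps_to W (@quasiequivalence D) P.
Hypothesis hQ : maps_to W (@quasiequivalence D) Q.

(** Whiskered with [s], the hats become the images of [cyl_α K], where naturality is [pn_nat];
    whiskering with [F1 Q s] is faithful. *)
Lemma hat_cyl_natural (X : C) (K : Cylinder W X) :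
  pn_natural (hat_cyl hP K) (hat_cyl hQ K).
Proof.
have [faithful _] := hQ (cyl_sW K).
have [γ [_ u]] := faithful _ _ _
  (F1 Q (cyl_s K) ◁ (pn1 σ (cyl_d1 K) ∘ (hat_cyl hQ K ▷ σ X))).
rewrite /pn_natural -(u _ erefl); symmetry; apply: u.
apply/pn_natural_lwhisk.
rewrite [pf_lwhisk _ _](hat_cylPB hP) [pf_lwhisk _ _](hat_cylPB hQ).
exact: pn_nat.
Qed.

Lemma hat_ht_natural (X Y : C) (f g : X ⟶ Y) (H : Homotopy W f g) :
  pn_natural (hat_ht hP H) (hat_ht hQ H).
Proof.
apply: pn_natural_vcomp; first exact: pn_nat.
apply: pn_natural_vcomp; last exact: pn_nat.
by apply/pn_natural_lwhisk; rewrite (hat_cyl_natural (ht_cyl H)).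
Qed.

Lemma hat_seq_natural (X Y : C) (f g : X ⟶ Y) (s : HSeq W f g) :
  pn_natural (hat_seq hP s) (hat_seq hQ s).
Proof.
elim: s => [k H|k l s IH H]; first exact: hat_ht_natural.
exact: pn_natural_vcomp (hat_ht_natural H) IH.
Qed.
End HatNaturality.

(** * Extension from [C] to [Ho] of pseudofunctors, transformations and modifications *)

Section Extension.
Variables (C : Bicategory) (W : arrow_family C) (W_id : contains_identities W).
Variable D : Bicategory.

Section OutOfHo.
Variable F : Pseudofunctor (Ho W_id) D.
Hypothesis hF : maps_to W (@quasiequivalence D) (compPF F (ho_i W_id)).

(** [F] preserves the equation [lwhisk_cyl_cell], which characterizes the hat. *)
Lemma F2_cyl_cell (X : C) (K : Cylinder W X) :
  @F2 _ _ F X (cyl_W K) (cyl_d0 K) (cyl_d1 K) (cyl_cell K) = hat_cyl hF K.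
Proof.
symmetry; refine (hat_cyl_uniq hF _); rewrite /= !F2_id !vidl vidr -lwhisk_cyl_cell.
by rewrite -[RHS](F2_hcomp F) F2_id.
Qed.

Lemma F2_ho_class (X Y : C) (f g : X ⟶ Y) (s : HSeq W f g) :
  @F2 _ _ F X Y f g (ho_class s) = hat_seq hF s.
Proof.
have one (k l : X ⟶ Y) (H : Homotopy W k l) :
    @F2 _ _ F X Y k l (ho_class (hs_one H)) = hat_ht hF H.
  rewrite (ho_class_ht W_id) 2!(@F2_comp _ _ F) -[X in _ ∘ (X ∘ _) = _](F2_hcomp F) F2_cyl_cell.
  by rewrite /hat_ht /= !F2_id !vidl !vidr.
elim: s => [k H|k l s IH H]; first exact: one.
(* Seen as a concatenation, the longer sequence has a vertical composite as its class. *)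
rewrite -[hs_cons s H]/(hs_cat s (hs_one H)) -ho_vcomp_class.
rewrite (@F2_comp _ _ F).
exact: (f_equal2 vcomp (one _ _ H) IH).
Qed.
End OutOfHo.

Section Extend.
Variable H : Pseudofunctor C D.
Hypothesis hH : maps_to W (@quasiequivalence D) H.

(** Independent of the representative by [hat_ho_repr], for any pseudofunctor [H] as above. *)
Definition eval2 (X Y : C) (f g : X ⟶ Y) (a : HoCell W f g) : F1 H f ⇒ F1 H g :=
  hat_seq hH (ho_repr a).

Lemma eval2_incl (X Y : C) (f g : X ⟶ Y) (μ : f ⇒ g) : eval2 (ho_incl W_id μ) = F2 H μ.
Proof. by rewrite /eval2 hat_ho_repr /= hat_I. Qed.

Lemma eval2_vcomp (X Y : C) (f g h : X ⟶ Y) (b : HoCell W g h) (a : HoCell W f g) :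
  eval2 (ho_vcomp b a) = eval2 b ∘ eval2 a.
Proof. by rewrite /eval2 hat_ho_repr hat_cat. Qed.

Lemma eval2_hcomp (X Y Z : C) (g g' : Y ⟶ Z) (f f' : X ⟶ Y)
    (b : HoCell W g g') (a : HoCell W f f') :
  eval2 (ho_hcomp b a) = phi H g' f' ∘ ((eval2 b ⊛ eval2 a) ∘ bwd (phi H g f)).
Proof.
rewrite eval2_vcomp /eval2 /ho_rwhisk /ho_lwhisk !hat_ho_repr hat_rwhisk hat_lwhisk.
exact: (@exch_rl (pullback H)).
Qed.

Program Definition extend : Pseudofunctor (Ho W_id) D :=
  {| F0 := fun X : Ho W_id => H X;
     F1 := fun X Y f => F1 H f;
     F2 := fun X Y f g a => eval2 a;
     phi := fun X Y Z g f => phi H g f;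
     xi := fun X => xi H X |}.
Next Obligation. by move=> X Y f; rewrite [LHS]eval2_incl F2_id. Qed.
Next Obligation. by move=> *; apply: eval2_vcomp. Qed.
Next Obligation.
by move=> X Y Z g g' f f' b a; rewrite /= eval2_hcomp !vassoc fwdK vidr.
Qed.
Next Obligation. by move=> *; rewrite /= eval2_incl; apply: phi_assoc. Qed.
Next Obligation. by move=> *; rewrite /= eval2_incl; apply: phi_lun. Qed.
Next Obligation. by move=> *; rewrite /= eval2_incl; apply: phi_run. Qed.

Lemma extendK : compPF extend (ho_i W_id) = H.
Proof.
apply: Build_Pseudofunctor_eqr => [X Y f g a|X Y Z g f|X] /=; first exact: eval2_incl.
- by rewrite eval2_incl F2_id vidl.
- by rewrite eval2_incl F2_id vidl.
Qed.
End Extend.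

Lemma extend_precomp (F : Pseudofunctor (Ho W_id) D)
    (hF : maps_to W (@quasiequivalence D) (compPF F (ho_i W_id))) :
  extend hF = F.
Proof.
apply: Build_Pseudofunctor_eqr => [X Y f g a|X Y Z g f|X] /=.
- by rewrite /eval2 -F2_ho_class ho_reprK.
- by rewrite [F2 F _](@F2_id _ _ F) vidl.
- by rewrite [F2 F _](@F2_id _ _ F) vidl.
Qed.

Section Extend1.
Variables F G : Pseudofunctor (Ho W_id) D.
Hypothesis hF : maps_to W (@quasiequivalence D) (compPF F (ho_i W_id)).
Hypothesis hG : maps_to W (@quasiequivalence D) (compPF G (ho_i W_id)).

Program Definition extend1
    (σ : Pseudonat (compPF F (ho_i W_id)) (compPF G (ho_i W_id))) : Pseudonat F G :=
  {| pn0 := fun X : Ho W_id => σ X;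
     pn1 := fun X Y f => pn1 σ f |}.
Next Obligation.
(* On a class, [F] and [G] take hats as values, so naturality is that of hats. *)
move=> σ X Y f g a; rewrite -(ho_reprK a) !(F2_ho_class hF) !(F2_ho_class hG).
exact: (hat_seq_natural σ hF hG (ho_repr a)).
Qed.
Next Obligation.
move=> σ X Y Z g f; have := pn_comp (p := σ) (g := g) (f := f).
by rewrite /= ![F2 F _](@F2_id _ _ F) ![F2 G _](@F2_id _ _ G) !vidl.
Qed.
Next Obligation.
move=> σ X; have := pn_id (p := σ) (X := X).
by rewrite /= ![F2 F _](@F2_id _ _ F) ![F2 G _](@F2_id _ _ G) !vidl.
Qed.

Lemma extend1K (σ : Pseudonat (compPF F (ho_i W_id)) (compPF G (ho_i W_id))) :
  pn_pre (ho_i W_id) (extend1 σ) = σ.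
Proof.
by case: σ => n0 n1 p1 p2 p3; rewrite /pn_pre; f_equal; apply: proof_irrelevance.
Qed.

Lemma extend1_pre (σ : Pseudonat F G) : extend1 (pn_pre (ho_i W_id) σ) = σ.
Proof.
by case: σ => n0 n1 p1 p2 p3; rewrite /extend1; f_equal; apply: proof_irrelevance.
Qed.

(** The axiom of a modification involves only arrows, and [Ho] has those of [C]. *)
Program Definition extend2 (σ τ : Pseudonat F G)
    (m : Modification (pn_pre (ho_i W_id) σ) (pn_pre (ho_i W_id) τ)) :
    Modification σ τ :=
  {| md0 := fun X : Ho W_id => m X |}.
Next Obligation. by move=> σ τ m X Y f; apply: (md_nat (m := m)). Qed.

End Extend1.
End Extension.

Theorem theorem3p53 (C : Bicategory) (W : arrow_family C)
  (W_id : contains_identities W)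
  (W_3for2 : three_for_two W)
  (W_split : split_generated W) :
  strict_localization W (ho_i W_id).
Proof.
have hi := ho_i_equivalence W_id W_3for2 W_split; exists hi => D.
(* Restricted along [ho_i], every [F] sends [W] to quasiequivalences, so its hats are defined. *)
have qF (F : Pseudofunctor (Ho W_id) D) :=
  maps_to_quasi (@maps_to_comp _ _ _ _ _ F hi).
refine (@bijective_is_isomorphism _ _ (precompW hi D)
  (fun F G σ => extend1 (qF F) (qF G) σ) (fun F G σ τ m => extend2 m) _ _ _ _ _
  (fun H : HomW W D => extend W_id (maps_to_quasi (proj2_sig H))) _).
- by move=> F G σ; apply: extend1_pre.
- by move=> F G σ; apply: extend1K.
- by move=> F G σ τ m; apply: mod_ext.
- by move=> F G σ τ m; apply: mod_ext.
(* Injectivity on objects: [F] and [G] are the extensions of their restrictions, which coincide. *)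
- move=> F G /(f_equal (@proj1_sig _ _)) /= e.
  rewrite -(extend_precomp (qF F)) -(extend_precomp (qF G)).
  by move: (qF F) (qF G); rewrite e => h h'; rewrite (proof_irrelevance _ h h').
- move=> [H hH]; apply: eq_sig_hprop => [P p q|]; first exact: proof_irrelevance.
  exact: extendK.
Qed.
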